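(* Let $T>0$, $A\in L^1(0,T;\mathbb{R}^{n\times n})$, $B\in L^2(0,T;\mathbb{R}^{n\times m})$, and assume that the system $[A,B]$ is completely controllable. Let $Q\in L^1(0,T;\mathbb{S}^n)$ with $Q\ge0$ a.e., and let $R\in L^\infty(0,T;\mathbb{S}^m)$ with $R(s)\ge\delta I$ for a.e. $s$, for some $\delta>0$. For each integer $i\ge1$ let $P_i\in C([0,T];\mathbb{S}^n)$ be the unique solution of $$\dot P_i(s)+P_i(s)A(s)+A(s)^\top P_i(s)+Q(s)-P_i(s)B(s)R(s)^{-1}B(s)^\top P_i(s)=0,\ s\in[0,T],\qquad P_i(T)=iI,$$ and let $P\in C([0,T);\mathbb{S}^n_+)$ be the unique solution of $$\dot P(s)+P(s)A(s)+A(s)^\top P(s)+Q(s)-P(s)B(s)R(s)^{-1}B(s)^\top P(s)=0,\ s\in[0,T),\qquad \lim_{s\to T}\min\sigma(P(s))=\infty.$$ Then: (i) for every $t\in[0,T)$, $P_i(t)$ is increasing in $i$ (i.e. $P_i(t)\le P_{i+1}(t)$) and $P_i(t)\to P(t)$ as $i\to\infty$; (ii) the sequence $\{P_i\}_{i=1}^\infty$ is uniformly bounded on compact subintervals of $[0,T)$.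
   Context: $\mathbb{S}^n$ is the space of symmetric real $n\times n$ matrices, $\mathbb{S}^n_+$ the set of symmetric positive definite ones; inequalities between symmetric matrices are in the positive semidefinite order. $\sigma(M)$ is the spectrum of $M$. Solutions of differential equations are in the Carathéodory sense (absolutely continuous on compact subintervals, equation satisfied a.e.). The existence and uniqueness of $P_i$ and of $P$ under the stated hypotheses is part of the setting. The system $[A,B]$ is completely controllable if for every $0\le t_0<t_1\le T$ and all $x,y\in\mathbb{R}^n$ there is $u\in L^2(t_0,t_1;\mathbb{R}^m)$ such that the solution of $\dot X(s)=A(s)X(s)+B(s)u(s)$ on $[t_0,t_1]$ with $X(t_0)=x$ satisfies $X(t_1)=y$. *)

(* Defs.v *)
From HB Require Import structures.
From mathcomp Require Import all_boot all_order all_algebra.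
From mathcomp Require Import all_classical all_reals all_analysis.
Set Implicit Arguments.
Unset Strict Implicit.
Unset Printing Implicit Defensive.
Import Order.TTheory GRing.Theory Num.Theory.
Import numFieldNormedType.Exports.
Local Open Scope classical_set_scope.
Local Open Scope ring_scope.

Definition possemidef (K : realType) (n : nat) (M : 'M[K]_n) : Prop :=
  M \is symmetricmx /\ forall v : 'cV[K]_n, 0 <= (v^T *m M *m v) 0 0.

Definition posdef (K : realType) (n : nat) (M : 'M[K]_n) : Prop :=
  M \is symmetricmx /\
  forall v : 'cV[K]_n, v != 0 -> 0 < (v^T *m M *m v) 0 0.

Definition loewner_le (K : realType) (n : nat) (M N : 'M[K]_n) : Prop :=
  possemidef (N - M).

(* For symmetric [M] of positive size the spectrum is real, finite and
   nonempty, so this infimum is a minimum. *)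
Definition min_spectrum (K : realType) (n : nat) (M : 'M[K]_n) : K :=
  inf [set a | eigenvalue M a].

(* [M] represents an element of L^p(a, b; K^(m x n)).  Only the values of [M]
   on ]a, b[ matter: the entries are extended by 0 outside. *)
Definition Lp_mx (K : realType) (p : \bar K) (a b : K) (m n : nat)
    (M : K -> 'M[K]_(m, n)) : Prop :=
  forall i j, (fun s => M s i j) \_ `]a, b[ \in Lfun (@lebesgue_measure K) p.

Definition abs_continuous (K : realType) (V : normedModType K) (a b : K)
    (f : K -> V) : Prop :=
  forall e : K, 0 < e -> exists2 d : K, 0 < d &
    forall (N : nat) (u v : 'I_N -> K),
      (forall k, a <= u k /\ u k <= v k /\ v k <= b) ->
      trivIset setT (fun k => `]u k, v k[%classic) ->
      \sum_(k < N) (v k - u k) < d ->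
      \sum_(k < N) `|f (v k) - f (u k)| < e.

(* Carathéodory solution of X'(s) = F(s, X(s)) on the interval [J].  The
   endpoints of [J] are negligible, so the two-sided derivative is harmless. *)
Definition caratheodory_sol (K : realType) (V : normedModType K) (J : set K)
    (F : K -> V -> V) (X : K -> V) : Prop :=
  (forall a b : K, `[a, b] `<=` J -> abs_continuous a b X) /\
  {ae @lebesgue_measure K, forall s, J s -> is_derive s (1 : K) X (F s (X s))}.

Definition completely_controllable (K : realType) (n m : nat) (T : K)
    (A : K -> 'M[K]_n) (B : K -> 'M[K]_(n, m)) : Prop :=
  forall t0 t1 : K, 0 <= t0 -> t0 < t1 -> t1 <= T ->
  forall x y : 'cV[K]_n,
  exists u : K -> 'cV[K]_m, Lp_mx 2%:E t0 t1 u /\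
  exists X : K -> 'cV[K]_n,
    [/\ caratheodory_sol `[t0, t1] (fun s z => A s *m z + B s *m u s) X,
        X t0 = x & X t1 = y].

Definition riccati_rhs (K : realType) (n m : nat) (A : K -> 'M[K]_n)
    (B : K -> 'M[K]_(n, m)) (Q : K -> 'M[K]_n) (R : K -> 'M[K]_m)
    (s : K) (P : 'M[K]_n) : 'M[K]_n :=
  - (P *m A s + (A s)^T *m P + Q s
     - P *m B s *m invmx (R s) *m (B s)^T *m P).

Definition riccati_sol (K : realType) (n m : nat) (A : K -> 'M[K]_n)
    (B : K -> 'M[K]_(n, m)) (Q : K -> 'M[K]_n) (R : K -> 'M[K]_m)
    (J : set K) (P : K -> 'M[K]_n) : Prop :=
  {within J, continuous P} /\ caratheodory_sol J (riccati_rhs A B Q R) P.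

(* Main.v *)
Require Import Defs.
From HB Require Import structures.
From mathcomp Require Import all_boot all_order all_algebra.
From mathcomp Require Import all_classical all_reals all_analysis.
From mathcomp Require Import measurable_realfun ring lra.
Set Implicit Arguments.
Unset Strict Implicit.
Unset Printing Implicit Defensive.
Import Order.TTheory GRing.Theory Num.Theory.
Import numFieldNormedType.Exports.
Local Open Scope classical_set_scope.
Local Open Scope ring_scope.

(** Two symmetric Riccati solutions [X], [Y] differ by a solution of a _linear_
    equation: with [S = B R^-1 B^T] and [F = A - S (X + Y) / 2], the difference
    [D = Y - X] satisfies [D' = - (D F + F^T D)].  The smallest eigenvalue of
    [D], damped by an exponential weight, is nonincreasing, so the sign of [D]
    propagates backwards in time.  This yields [P_i <= P_(i+1)], and also
    [P_i <= P] because near [T] the blow-up of [P] beats the bounded [P_i].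

    For the convergence, the same computation applies to the inverses:
    [P_i^-1 - P^-1] solves a linear equation whose coefficients are dominated by
    an integrable function up to [T], uniformly in [i], since [P_i >= P_1 >= c]
    on [[0, T]].  Both inverses are [O(1 / i)] close to [T], hence so is their
    difference at every [t < T].

    The a.e. equations are exploited without the fundamental theorem of calculus
    for absolutely continuous functions: such a function decreases as soon as it
    is touched from above, at almost every point, by a function with nonpositive
    derivative. *)

(** * Absolutely continuous functions: monotonicity, stability, primitives *)

Lemma abs_continuous_diff (K : realType) (V : normedModType K) (a b : K)
    (f : K -> V) : abs_continuous a b f -> forall e : K, 0 < e ->
  exists2 d : K, 0 < d &
    forall x y, a <= x -> x <= y -> y <= b -> y - x < d -> `|f y - f x| < e.
Proof.
move=> acf e e0; have [d d0 dP] := acf e e0; exists d => // x y ax xy yb yxd.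
have := dP 1%N (fun=> x) (fun=> y).
rewrite !big_ord_recl !big_ord0 !addr0; apply => //.
by apply/trivIsetP => i j _ _; rewrite (ord1 i) (ord1 j) eqxx.
Qed.

Lemma is_derive_right_le (K : realType) (h : K -> K) (c dh e : K) :
  is_derive c 1 h dh -> dh <= 0 -> 0 < e ->
  exists2 r, 0 < r & forall y, c < y -> y < c + r -> h y - h c <= e * (y - c).
Proof.
move=> hd dh0 e0.
have hl : t^-1 *: (h (t + c) - h c) @[t --> 0^'] --> dh.
  have [/cvg_ex[l hl] dE] := hd.
  have hl' : t^-1 *: (h (t + c) - h c) @[t --> 0^'] --> l.
    apply: cvg_trans hl; apply: near_eq_cvg; near=> t.
    by rewrite /= [X in X + c]mulr1.
  suff <- : l = dh by [].
  rewrite -dE; apply/esym/cvg_lim => //=.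
move/cvgrPdist_lt : hl => /(_ e e0).
move=> /nbhs_ballP[r /= r0 rP].
exists r => // y cy yr.
have yc0 : 0 < y - c by rewrite subr_gt0.
have /rP : ball 0 r (y - c).
  by rewrite /ball /= sub0r normrN gtr0_norm// ltrBlDl.
rewrite subrK => /(_ (lt0r_neq0 yc0)) hy.
have {}hy : (y - c)^-1 *: (h y - h c) < e.
  move: hy; rewrite ltr_norml => /andP[+ _].
  by rewrite -subr_gt0 opprK => hy; rewrite -subr_gt0; lra.
rewrite -ler_pdivrMr// mulrC; exact: ltW.
Unshelve. all: by end_near. Qed.

(* Continuous induction along [a, b]: the exceptional null set is covered by an
   open set too small for [g] to vary on it, and outside of it the touching
   functions control the growth of [g]. *)
Lemma abs_continuous_touch_nonincreasing (K : realType) (a b : K) (g : K -> K) :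
  a <= b -> abs_continuous a b g ->
  {ae @lebesgue_measure K, forall s, a < s -> s < b ->
     exists (h : K -> K) (dh : K), [/\ is_derive s 1 h dh, dh <= 0, h s = g s &
       forall y, s <= y -> y <= b -> g y <= h y]} ->
  g b <= g a.
Proof.
move=> ab acg Hae.
(* The endpoint [a] is added to the range of [s] at the price of a null set, since the supremum [c]
   below may be [a] itself. *)
have {Hae} [A [mA A0 PA]] : {ae @lebesgue_measure K, forall s, a <= s -> s < b ->
     exists (h : K -> K) (dh : K), [/\ is_derive s 1 h dh, dh <= 0, h s = g s &
       forall y, s <= y -> y <= b -> g y <= h y]}.
  have FF := ae_filter_ringOfSetsType (@lebesgue_measure K).
  have sa : {ae @lebesgue_measure K, forall s, s != a}.
    exists [set a]; split => //; first exact: lebesgue_measure_set1.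
    by move=> s /= /negP; rewrite negbK => /eqP.
  apply: filterS2 sa Hae => s sa Hs as_ sb.
  by apply: Hs => //; rewrite lt_neqAle eq_sym sa.
apply/ler_addgt0Pr => e0 e00.
(* The error budget: [e * (b - a)] for the slopes of the touching functions, [e] for the variation
   of [g] over [U], and [e] for the final slack [eta]. *)
pose e := e0 / (b - a + 2).
have D0 : 0 < b - a + 2 by move: ab; rewrite -subr_ge0 => ab; lra.
have e_gt0 : 0 < e by rewrite divr_gt0.
have [d d0 dP] := acg e e_gt0.
have [|U [oU AU UAd]] := lebesgue_regularity_outer mA _ d0.
  by apply: (le_lt_trans (y := 0%E)) => //; rewrite le_eqVlt; apply/orP; left; apply/eqP; exact: A0.
have Ud : (lebesgue_measure U < d%:E)%E.
  have mU := open_measurable oU.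
  have A0' : lebesgue_measure A = 0%E by exact: A0.
  rewrite (le_lt_trans _ UAd)// -[leRHS]add0e -A0'.
  by rewrite -{1}(setDUK AU) (le_trans (measureU2 _ _ _))//; exact: measurableD.
(* Ordered intervals inside [U] and to the left of [x]. The variation of [g] over them is carried
   along as a sum and estimated only once, at the end. *)
pose fam x N (u v : nat -> K) :=
  (forall k, (k < N)%N -> [/\ a <= u k, u k <= v k, v k <= x & `]u k, v k[ `<=` U])
  /\ (forall j k, (j < k < N)%N -> v j <= u k).
(* The slack [eta] makes [S] contain its supremum: a family that serves for a nearby [x] also serves
   for [c], by continuity of [g]. *)
pose S := [set x | a <= x <= b /\ forall eta, 0 < eta -> exists N u v,
   fam x N u v /\ g x - g a <= e * (x - a) + \sum_(k < N) `|g (v k) - g (u k)| + eta].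
have Sa : S a.
  split; first by rewrite lexx ab.
  move=> eta eta0; exists 0%N, (fun=> 0), (fun=> 0).
  split; first by split => // j k; rewrite ltn0 andbF.
  by rewrite !subrr big_ord0 mulr0 !add0r ltW.
have Sb : has_sup S.
  by split; [exists a | exists b => x [/andP[]]].
set c := sup S.
have ac : a <= c by apply: ub_le_sup => //; exact: Sb.2.
have cb : c <= b by apply: ge_sup; [exists a|move=> x [/andP[]]].
have Sc : S c.
  split; first by rewrite ac cb.
  move=> eta eta0.
  have [d1 d10 d1P] := abs_continuous_diff acg (divr_gt0 eta0 (ltr0n _ 2)).
  have [x Sx xc] := sup_adherent d10 Sb.
  have xlec : x <= c by apply: ub_le_sup => //; exact: Sb.2.
  have [/andP[ax xb] /(_ _ (divr_gt0 eta0 (ltr0n _ 2)))[N [u [v [[F1 F2] guv]]]]] := Sx.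
  exists N, u, v; split.
    by split=> // k /F1[? ? vx ?]; split=> //; rewrite (le_trans vx).
  have := d1P _ _ ax xlec cb _; rewrite ltrBlDr -ltrBlDl => /(_ xc).
  rewrite ltr_norml => /andP[_ gcx].
  have : e * (x - a) <= e * (c - a) by rewrite ler_pM2l// lerB.
  set s := \sum_(k < N) _ in guv *; move: guv gcx; lra.
have step y : c < y -> y <= b -> S y -> False.
  move=> cy yb Sy; have : y <= c by apply: ub_le_sup => //; exact: Sb.2.
  by rewrite leNgt cy.
have cbE : c = b.
  apply/eqP; rewrite eq_le cb leNgt; apply/negP => cltb.
  (* Either [c] is exceptional, and a short interval starting at [c] lies in [U] and is appended to
     the family, or the touching function at [c] bounds the growth of [g] by the slope [e]. Both go
     past the supremum. *)
  have [Ac|nAc] := pselect (A c).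
    have /nbhs_ballP[r /= r0 rU] := (open_nbhs_nbhs (conj oU (AU _ Ac))).
    pose y := Num.min (c + r / 2) b.
    have cy : c < y by rewrite /y lt_min cltb ltrDl divr_gt0.
    have yb : y <= b by rewrite /y ge_min lexx orbT.
    apply: (step y) => //; split; first by rewrite yb (le_trans ac (ltW cy)).
    move=> eta eta0; have [N [u [v [[F1 F2] guv]]]] := Sc.2 eta eta0.
    exists N.+1, (fun k => if (k < N)%N then u k else c),
       (fun k => if (k < N)%N then v k else y); split; [split|].
    - move=> k; rewrite ltnS leq_eqVlt => /orP[/eqP ->|kN].
        rewrite ltnn; split => //; first exact: ltW.
        apply: subset_trans rU => z; rewrite /= in_itv/= /ball/= => /andP[cz zy].
        rewrite distrC gtr0_norm ?subr_gt0// ltrBlDl (lt_le_trans zy)//.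
        rewrite /y ge_min; apply/orP; left; move: (r0); lra.
      rewrite kN; have [? ? vc ?] := F1 _ kN; split => //.
      by rewrite (le_trans vc)// ltW.
    - move=> j k /andP[jk]; rewrite ltnS leq_eqVlt => /orP[/eqP kN|kN].
        move: jk; rewrite kN ltnn => jk; rewrite jk.
        by have [] := F1 _ jk.
      by rewrite kN (ltn_trans jk kN); apply: F2; rewrite jk.
    rewrite big_ord_recr/= ltnn.
    rewrite (eq_bigr (fun k : 'I_N => `|g (v k) - g (u k)|)); last first.
      by move=> k _; rewrite ltn_ord.
    have : e * (c - a) <= e * (y - a) by rewrite ler_pM2l// lerB// ltW.
    have := ler_norm (g y - g c).
    set s := \sum_(k < N) _ in guv *; move: guv; lra.
  have [h [dh [hd dh0 hc gh]]] : exists (h : K -> K) (dh : K), [/\ is_derive c 1 h dh, dh <= 0, h c = g c &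
       forall y, c <= y -> y <= b -> g y <= h y].
    by apply: contrapT => H; apply: nAc; apply: PA => /= H2; apply: H; exact: H2.
  have [r r0 hr] := is_derive_right_le hd dh0 e_gt0.
  pose y := Num.min (c + r / 2) b.
  have cy : c < y by rewrite /y lt_min cltb ltrDl divr_gt0.
  have yb : y <= b by rewrite /y ge_min lexx orbT.
  have yr : y < c + r.
    rewrite (@le_lt_trans _ _ (c + r / 2))//; first by rewrite /y ge_min lexx.
    by move: (r0); lra.
  apply: (step y) => //; split; first by rewrite yb (le_trans ac (ltW cy)).
  move=> eta eta0; have [N [u [v [[F1 F2] guv]]]] := Sc.2 eta eta0.
  exists N, u, v; split.
    split => // k kN; have [? ? vc ?] := F1 _ kN; split => //.
    by rewrite (le_trans vc)// ltW.
  have := gh _ (ltW cy) yb; have := hr _ cy yr; rewrite hc.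
  set s := \sum_(k < N) _ in guv *.
  rewrite (_ : e * (y - a) = e * (c - a) + e * (y - c)); last by ring.
  move: guv; lra.
have [N [u [v [[F1 F2] guv]]]] := Sc.2 e e_gt0.
(* The intervals are disjoint subsets of [U], hence of total length below [d], and absolute
   continuity applies to the whole family. *)
suff : \sum_(k < N) `|g (v k) - g (u k)| < e.
  have e0E : e0 = e * (b - a + 2) by rewrite /e mulfVK// gt_eqF.
  rewrite cbE in guv.
  set s := \sum_(k < N) _ in guv *; rewrite e0E => se.
  have -> : e * (b - a + 2) = e * (b - a) + 2 * e by ring.
  move: guv; lra.
have tri : trivIset setT (fun k : 'I_N => `]u k, v k[%classic).
  apply/trivIsetP => i j _ _ ij; apply/seteqP; split => // z [] /=.
  rewrite !in_itv/= => /andP[ui vi] /andP[uj vj].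
  have : (i < j)%N || (j < i)%N by rewrite -neq_ltn.
  case/orP => lt.
    have := F2 i j; rewrite lt ltn_ord => /(_ isT) vu.
    by have := lt_trans (lt_le_trans vi vu) uj; rewrite ltxx.
  have := F2 j i; rewrite lt ltn_ord => /(_ isT) vu.
  by have := lt_trans (lt_le_trans vj vu) ui; rewrite ltxx.
apply: (dP N (fun k => u k) (fun k => v k)) => //.
  move=> k; have [? ? vc _] := F1 k (ltn_ord k).
  by split => //; split => //; rewrite (le_trans vc).
rewrite -lte_fin (le_lt_trans _ Ud)//.
have -> : (\sum_(k < N) (v k - u k))%:E =
    (\sum_(k < N) lebesgue_measure `]u k, v k[%classic)%E.
  rewrite -sumEFin; apply: eq_bigr => k _.
  have [_ uv _ _] := F1 k (ltn_ord k).
  by rewrite lebesgue_measure_itv/= lte_fin; case: ltgtP uv => // -> _; rewrite subrr.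
rewrite -measure_bigsetU_ord//.
apply: le_measure; rewrite ?inE; [exact: bigsetU_measurable|exact: open_measurable|].
by elim/big_ind : _ => // [X Y XU YU x [/XU|/YU]//|k _]; have [] := F1 k (ltn_ord k).
Qed.

(** The increments may be summed interval by interval. Differences, products, minima, exponentials,
    inverses and smallest eigenvalues are all shown absolutely continuous through this criterion. *)
Lemma abs_continuous_dominated (K : realType) (V W U : normedModType K)
    (a b C : K) (f : K -> V) (g : K -> W) (h : K -> U) :
  abs_continuous a b f -> abs_continuous a b g ->
  (forall x y, a <= x -> x <= y -> y <= b ->
     `|h y - h x| <= C * (`|f y - f x| + `|g y - g x|)) ->
  abs_continuous a b h.
Proof.
move=> acf acg hfg e e0.
pose C' := `|C| + 1.
have C'0 : 0 < C' by rewrite ltr_wpDl.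
have e'0 : 0 < e / 2 / C' by rewrite !divr_gt0.
have [d1 d10 d1P] := acf _ e'0; have [d2 d20 d2P] := acg _ e'0.
exists (Num.min d1 d2); first by rewrite lt_min d10.
move=> N u v uv tri; rewrite lt_min => /andP[s1 s2].
have := d1P N u v uv tri s1; rewrite (ltr_pdivlMr _ _ C'0) => fe.
have := d2P N u v uv tri s2; rewrite (ltr_pdivlMr _ _ C'0) => ge.
apply: (@le_lt_trans _ _ (\sum_(k < N) C' * (`|f (v k) - f (u k)| + `|g (v k) - g (u k)|))).
  apply: ler_sum => k _; have [au [uvk vb]] := uv k.
  apply: le_trans (hfg _ _ au uvk vb) _.
  by rewrite ler_wpM2r ?addr_ge0// (le_trans (ler_norm C))// lerDl.
rewrite -mulr_sumr big_split/= mulrDr.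
move: fe ge.
set A := \sum_(k < N) _; set B := \sum_(k < N) _.
rewrite mulrC (mulrC B); move: (C' * A) (C' * B) => x y; lra.
Qed.

Lemma abs_continuousS (K : realType) (V : normedModType K) (a b c d : K)
    (f : K -> V) : c <= a -> b <= d -> abs_continuous c d f -> abs_continuous a b f.
Proof.
move=> ca bd acf e e0; have [r r0 rP] := acf e e0; exists r => // N u v uv tri lt.
by apply: rP => // k; have [? [? ?]] := uv k; split; [exact: le_trans ca _|split => //; exact: le_trans bd].
Qed.

Lemma abs_continuous_cst (K : realType) (V : normedModType K) (a b : K) (c : V) :
  abs_continuous a b (fun=> c).
Proof.
by move=> e e0; exists 1 => // N u v _ _ _; rewrite big1// => k _; rewrite subrr normr0.
Qed.

Lemma abs_continuous_bounded (K : realType) (V : normedModType K) (a b : K)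
    (f : K -> V) : abs_continuous a b f ->
  exists2 M, 0 <= M & forall x, a <= x -> x <= b -> `|f x| <= M.
Proof.
move=> acf; have [d d0 dP] := abs_continuous_diff acf ltr01.
(* Walking from [a] in steps of length [d / 2], each step changes [f] by less than 1. *)
have H n x : a <= x -> x <= b -> x - a <= n%:R * (d / 2) -> `|f x| <= `|f a| + n%:R.
  elim: n x => [|n IH] x ax xb.
    rewrite mul0r subr_le0 => xa; have -> : x = a by apply/eqP; rewrite eq_le xa.
    by rewrite addr0.
  move=> xn; have [xa|xa] := leP x (a + d / 2).
    have : `|f x - f a| < 1 by apply: dP => //; move: xa (d0); lra.
    have := ler_normD (f x - f a) (f a); rewrite subrK.
    have : 1 <= n.+1%:R :> K by rewrite ler1n.
    by lra.
  have xE : x - (x - d / 2) < d by move: (d0); lra.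
  have h1 : a <= x - d / 2 by lra.
  have h2 : x - d / 2 <= x by move: (d0); lra.
  have := dP _ _ h1 h2 xb xE.
  have h3 : x - d / 2 - a <= n%:R * (d / 2).
    by move: xn; rewrite -natr1 mulrDl mul1r; lra.
  have := IH _ h1 (le_trans h2 xb) h3.
  have := ler_normD (f x - f (x - d / 2)) (f (x - d / 2)); rewrite subrK -natr1.
  by lra.
pose n := Num.bound ((b - a) / (d / 2)).
exists (`|f a| + n%:R); first by rewrite addr_ge0.
move=> x ax xb; apply: H => //.
rewrite -ler_pdivrMr ?divr_gt0//.
apply: (@le_trans _ _ ((b - a) / (d / 2))).
  by rewrite ler_pM2r ?invr_gt0 ?divr_gt0// lerB.
have := archi_boundP (divr_ge0 (_ : 0 <= b - a) (ltW (divr_gt0 d0 (ltr0n K 2)))).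
by move=> h; apply/ltW/h; rewrite subr_ge0 (le_trans ax).
Qed.

(** Supplies the exponent of the damping weight. The primitive of [k] is bounded by the total
    integral, absolutely continuous by absolute continuity of the integral, and differentiable
    almost everywhere by Lebesgue's theorem. *)
Lemma integral_primitive (K : realType) (k : K -> K) :
  k \in Lfun (@lebesgue_measure K) 1 -> (forall x, 0 <= k x) ->
  exists kap : K -> K, exists M : K,
  [/\ forall x, 0 <= kap x <= M, forall a b, abs_continuous a b kap &
   {ae @lebesgue_measure K, forall s, is_derive s (1 : K) kap (k s)}].
Proof.
move=> /Lfun1_integrable ik k0.
set mu := @lebesgue_measure K in ik *.
have ikS (A : set K) : measurable A -> mu.-integrable A (EFin \o k).
  by move=> mA; apply: (integrableS _ _ _ ik).
pose kap x := (\int[mu]_(t in `]-oo, x]) k t)%R.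
have incr (A B : set K) : measurable A -> measurable B -> A `<=` B ->
    (\int[mu]_(t in A) k t <= \int[mu]_(t in B) k t)%R.
  move=> mA mB AB; rewrite /Rintegral; apply: fine_le.
  - by apply: integrable_fin_num => //; exact: ikS.
  - by apply: integrable_fin_num => //; exact: ikS.
  apply: ge0_subset_integral => //; last by move=> x _; rewrite lee_fin.
  by have /integrableP[] := ikS _ mB.
exists kap, (\int[mu]_(t in setT) k t)%R; split.
- by move=> x; rewrite Rintegral_ge0//=; apply: incr.
- move=> a b e e0.
  have [d [d0 dP]] := integral_normr_continuous ik e0.
  exists d => // N u v uv tri lt.
  have kapE i : `|kap (v i) - kap (u i)| = (\int[mu]_(t in `]u i, v i[) k t)%R.
    have [_ [uvi _]] := uv i.
    rewrite /kap Rintegral_itvB//; last 1 first.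
      exact: ikS.
    rewrite -Rintegral_itv_bndo_bndc; last exact: ikS.
    by rewrite ger0_norm// Rintegral_ge0.
  under eq_bigr do rewrite kapE.
  have mU : measurable (\big[setU/set0]_(i < N) `]u i, v i[%classic).
    by apply: bigsetU_measurable.
  have -> : \sum_(i < N) (\int[mu]_(t in `]u i, v i[) k t)%R =
     (\int[mu]_(t in \big[setU/set0]_(i < N) `]u i, v i[%classic) `|k t|)%R.
    transitivity (\int[mu]_(t in \big[setU/set0]_(i < N) `]u i, v i[%classic) k t)%R; last first.
      by apply: eq_Rintegral => x _; rewrite ger0_norm.
    rewrite /Rintegral integral_bigsetU_EFin//=.
    - rewrite sum_fine// => i _; apply: integrable_fin_num => //; exact: ikS.
    - exact: index_enum_uniq.
    - by apply: sub_trivIset tri.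
    - by have /integrableP[] := ikS _ mU.
  apply: dP => //.
  rewrite measure_bigsetU_ord//.
  rewrite (eq_bigr (fun i => (v i - u i)%:E)) ?sumEFin ?lte_fin// => i _.
  have [_ [uvi _]] := uv i.
  have := lebesgue_measure_itv `]u i, v i[; rewrite /= lte_fin /mu => ->.
  by case: ltgtP uvi => // -> _; rewrite subrr.
- have loc : locally_integrable setT k by apply: open_integrable_locally => //; exact: openT.
  have := FTC1Ny (fun y => ikS _ (measurable_itv _)) loc.
  apply: filterS; first exact: (ae_filter_ringOfSetsType mu).
  by move=> x /= [d1 d2]; apply: DeriveDef => //; rewrite -derive1E.
Qed.

(** * The entrywise maximum norm of matrices *)

Section matrix_norm.
Variables (K : realType).

Lemma ler_mx_norm (m n : nat) (M : 'M[K]_(m, n)) i j : `|M i j| <= `|M|.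
Proof.
rewrite [leRHS]/Num.Def.normr/= mx_normrE.
exact: (le_bigmax _ (fun ij => `|M ij.1 ij.2|) (i, j)).
Qed.

Lemma mx_norm_le (m n : nat) (M : 'M[K]_(m, n)) c :
  0 <= c -> (forall i j, `|M i j| <= c) -> `|M| <= c.
Proof.
move=> c0 Mc; rewrite [leLHS]/Num.Def.normr/= mx_normrE.
by apply: bigmax_le => // -[i j] _ /=.
Qed.

Lemma mx_norm_mul (m n p : nat) (M : 'M[K]_(m, n)) (N : 'M[K]_(n, p)) :
  `|M *m N| <= n%:R * `|M| * `|N|.
Proof.
apply: mx_norm_le; first by rewrite !mulr_ge0.
move=> i j; rewrite !mxE (le_trans (ler_norm_sum _ _ _))//.
apply: (@le_trans _ _ (\sum_(k < n) `|M| * `|N|)).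
  by apply: ler_sum => k _; rewrite normrM ler_pM// ler_mx_norm.
by rewrite sumr_const card_ord -mulrA mulr_natl.
Qed.

Lemma mx_norm_tr (m n : nat) (M : 'M[K]_(m, n)) : `|M^T| = `|M|.
Proof.
apply/eqP; rewrite eq_le; apply/andP; split; apply: mx_norm_le => // i j.
  by rewrite mxE ler_mx_norm.
by have := ler_mx_norm M^T j i; rewrite mxE.
Qed.

Lemma mx_cvgP (T : Type) (F : set_system T) {FF : Filter F} (m n : nat)
    (f : T -> 'M[K]_(m, n)) (l : 'M[K]_(m, n)) :
  (f @ F --> l) <-> (forall i j, f x i j @[x --> F] --> l i j).
Proof.
split=> [fl i j|fl]; first exact: (cvg_comp _ (fun M : 'M[K]_(m, n) => M i j) fl (@coord_continuous K m n i j l)).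
apply/cvgrPdist_le => /= e e0; near=> x.
apply: mx_norm_le; first exact: ltW.
move=> i j; rewrite !mxE; move: i j; near: x.
apply: filter_forall => i; apply: filter_forall => j.
exact: ((cvgrPdist_le _ _).1 (fl i j)).
Unshelve. all: by end_near. Qed.

Lemma cvg_mulmx (T : Type) (F : set_system T) {FF : Filter F} (m n p : nat)
    (f : T -> 'M[K]_(m, n)) (g : T -> 'M[K]_(n, p)) (A : 'M[K]_(m, n)) (B : 'M[K]_(n, p)) :
  f @ F --> A -> g @ F --> B -> (f x *m g x) @[x --> F] --> A *m B.
Proof.
move=> /mx_cvgP fA /mx_cvgP gB; apply/mx_cvgP => i j.
under eq_fun do rewrite mxE.
rewrite mxE; have := @cvg_big K 'I_n +%R 0 xpredT (@add_continuous _) T F (index_enum _)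
  (fun k x => f x i k * g x k j) (fun k => A i k * B k j) FF; apply => k _.
by apply: cvgM; [exact: fA|exact: gB].
Qed.

End matrix_norm.

(** * Quadratic forms, and the bounds on matrices and inverses that they give *)

Section quadratic_form.
Variables (K : realType) (n : nat).
Implicit Types (M : 'M[K]_n) (v w : 'cV[K]_n).

Definition qform M v : K := (v^T *m M *m v) 0 0.
(** The squared Euclidean norm, whereas [|v|] is the maximum of the entries; passing from one to the
    other is a source of the powers of [n] in the constants. *)
Definition sqn v : K := (v^T *m v) 0 0.

Lemma sqnE v : sqn v = \sum_i v i 0 ^+ 2.
Proof. by rewrite /sqn mxE; apply: eq_bigr => i _; rewrite !mxE expr2. Qed.

Lemma sqn_ge0 v : 0 <= sqn v.
Proof. by rewrite sqnE sumr_ge0// => i _; rewrite sqr_ge0. Qed.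

Lemma sqr_mx_norm_le_sqn v : `|v| ^+ 2 <= sqn v.
Proof.
rewrite -[leRHS]sqr_sqrtr ?sqn_ge0// ler_sqr ?nnegrE ?sqrtr_ge0//.
apply: mx_norm_le => [|i j]; first exact: sqrtr_ge0.
rewrite -ler_sqr ?nnegrE ?sqrtr_ge0// sqr_sqrtr ?sqn_ge0// sqnE.
rewrite (ord1 j) (bigD1 i)//= real_normK ?num_real// lerDl sumr_ge0// => k _.
exact: sqr_ge0.
Qed.

Lemma sqn_gt0 v : v != 0 -> 0 < sqn v.
Proof.
move=> v0; apply: lt_le_trans (sqr_mx_norm_le_sqn v).
by rewrite exprn_gt0// normr_gt0.
Qed.

Lemma qform_norm M v : `|qform M v| <= n%:R ^+ 2 * `|M| * sqn v.
Proof.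
rewrite (le_trans (ler_mx_norm _ _ _))// (le_trans (mx_norm_mul _ _))//.
apply: (@le_trans _ _ (n%:R * (n%:R * `|v^T| * `|M|) * `|v|)).
  by rewrite ler_wpM2r// ler_wpM2l// mx_norm_mul.
rewrite mx_norm_tr [leLHS](_ : _ = n%:R ^+ 2 * `|M| * `|v| ^+ 2); last by ring.
by rewrite ler_wpM2l ?mulr_ge0 ?exprn_ge0// sqr_mx_norm_le_sqn.
Qed.

Lemma qformD M N v : qform (M + N) v = qform M v + qform N v.
Proof. by rewrite /qform mulmxDr mulmxDl mxE. Qed.

Lemma qformN M v : qform (- M) v = - qform M v.
Proof. by rewrite /qform mulmxN mulNmx mxE. Qed.

Lemma qformB M N v : qform (M - N) v = qform M v - qform N v.
Proof. by rewrite qformD qformN. Qed.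

Lemma qform_scalar c v : qform c%:M v = c * sqn v.
Proof. by rewrite /qform mul_mx_scalar -scalemxAl mxE. Qed.

Lemma qform0 v : qform 0 v = 0.
Proof. by rewrite /qform mulmx0 mul0mx mxE. Qed.

Lemma symmetricmxP M : (M \is symmetricmx) <-> M^T = M.
Proof.
split=> [/is_hermitianmxP|MT]; last apply/is_hermitianmxP.
  by rewrite expr0 scale1r map_mx_id// => {2}->.
by rewrite expr0 scale1r map_mx_id.
Qed.

Lemma qform_add_tr M v w : M^T = M ->
  qform M (v + w) = qform M v + 2 * (w^T *m M *m v) 0 0 + qform M w.
Proof.
move=> MT; rewrite /qform [(v + w)^T]linearD/= !mulmxDl !mulmxDr.
rewrite mxE [X in X + _ = _]mxE [X in _ + X = _]mxE.
have -> : (v^T *m M *m w) 0 0 = (w^T *m M *m v) 0 0.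
  by rewrite -[in LHS](trmxK (v^T *m M *m w)) mxE !trmx_mul trmxK MT mulmxA.
by ring.
Qed.

(** Polarization at basis vectors: four times an entry is the difference of the form at [e j + e i]
    and at [e j - e i], whose squared lengths add up to 4 by the parallelogram law. *)
Lemma mx_norm_qform_le M c : 0 <= c -> M^T = M ->
  (forall v, `|qform M v| <= c * sqn v) -> `|M| <= c.
Proof.
move=> c0 MT Mc; apply: mx_norm_le => // i j.
pose e k : 'cV[K]_n := delta_mx k 0.
have eMe k l : ((e k)^T *m M *m e l) 0 0 = M k l.
  by rewrite /e trmx_delta -mulmxA -colE -rowE !mxE.
have sqe k : sqn (e k) = 1.
  rewrite sqnE (bigD1 k)//= !mxE !eqxx expr1n big1 ?addr0// => l lk.
  by rewrite !mxE (negbTE lk) expr0n.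
have sqNe (u : 'cV[K]_n) : sqn (- u) = sqn u.
  by rewrite !sqnE; apply: eq_bigr => k _; rewrite !mxE sqrrN.
have sqD (u w : 'cV[K]_n) : sqn (u + w) + sqn (u - w) = 2 * sqn u + 2 * sqn w.
  rewrite !sqnE !mulr_sumr -!big_split/=; apply: eq_bigr => k _.
  by rewrite !mxE; ring.
have qD := qform_add_tr (e j) (e i) MT.
have qB := qform_add_tr (e j) (- e i) MT.
have qN : qform M (- e i) = qform M (e i).
  by rewrite /qform [(- e i)^T]linearN/= !mulNmx mulmxN opprK.
have := Mc (e j + e i); have := Mc (e j - e i).
rewrite qD qB qN [(- e i)^T]linearN/= !mulNmx [X in _ + 2 * X + _]mxE !eMe.
have := sqD (e j) (e i); rewrite !sqe => sqE.
have {sqE} -> : sqn (e j - e i) = 4 - sqn (e j + e i) by lra.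
rewrite !ler_norml mulrBr => /andP[? ?] /andP[? ?].
by apply/andP; split; lra.
Qed.

Lemma qform_ge_unitmx M c : 0 < c -> (forall v, c * sqn v <= qform M v) ->
  M \in unitmx.
Proof.
move=> c0 Mc; rewrite -unitmx_tr -row_free_unit; apply/inj_row_free => v vM.
have : v^T = 0.
  apply/eqP/negP => /negP v0; have := Mc v^T.
  rewrite /qform trmxK -mulmxA -(trmxK M) -trmx_mul vM trmx0 mulmx0 mxE.
  by rewrite leNgt mulr_gt0// sqn_gt0.
by move/(congr1 trmx); rewrite trmxK trmx0.
Qed.

(** For [v] the [j]-th column of the inverse, [M *m v] is a basis vector and the form at [v] is the
    entry [v j 0]. Hence [c * |v|^2 <= |v|] in the maximum norm. *)
Lemma qform_ge_invmx_norm M c : 0 < c -> (forall v, c * sqn v <= qform M v) ->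
  `|invmx M| <= c^-1.
Proof.
move=> c0 Mc; apply: mx_norm_le => [|i j]; first by rewrite invr_ge0 ltW.
have uM := qform_ge_unitmx c0 Mc.
pose v := col j (invmx M).
have vj : qform M v = v j 0.
  rewrite /qform -mulmxA [M *m v](_ : _ = delta_mx j 0); last first.
    by rewrite /v colE mulmxA mulmxV// mul1mx.
  by rewrite -colE !mxE.
have -> : invmx M i j = v i 0 by rewrite mxE.
apply: le_trans (ler_mx_norm v i 0) _.
have [->|v0] := eqVneq v 0; first by rewrite normr0 invr_ge0 ltW.
have nv0 : 0 < `|v| by rewrite normr_gt0.
rewrite -(ler_pM2l c0) mulfV ?gt_eqF// -(ler_pM2r nv0) mul1r -mulrA -expr2.
apply: (@le_trans _ _ (c * sqn v)); first by rewrite ler_pM2l// sqr_mx_norm_le_sqn.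
by rewrite (le_trans (Mc v))// vj (le_trans (ler_norm _))// ler_mx_norm.
Qed.

Lemma invmx_sub M N : M \in unitmx -> N \in unitmx ->
  invmx M - invmx N = - (invmx M *m (M - N) *m invmx N).
Proof.
move=> uM uN; rewrite mulmxBr mulmxBl mulVmx// mul1mx -mulmxA mulmxV//.
by rewrite mulmx1 opprB.
Qed.

Lemma invmx_dist M N c : 0 < c ->
  (forall v, c * sqn v <= qform M v) -> (forall v, c * sqn v <= qform N v) ->
  `|invmx M - invmx N| <= (n%:R / c) ^+ 2 * `|M - N|.
Proof.
move=> c0 Mc Nc; rewrite invmx_sub ?(qform_ge_unitmx c0)// normrN.
have iM := qform_ge_invmx_norm c0 Mc; have iN := qform_ge_invmx_norm c0 Nc.
rewrite (le_trans (mx_norm_mul _ _))//.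
apply: (@le_trans _ _ (n%:R * (n%:R * c^-1 * `|M - N|) * c^-1)).
  rewrite !ler_pM ?mulr_ge0//.
  by rewrite (le_trans (mx_norm_mul _ _))// ler_pM ?mulr_ge0// ler_wpM2l.
by rewrite le_eqVlt; apply/orP; left; apply/eqP; ring.
Qed.

End quadratic_form.

(** * The smallest eigenvalue as a minimum of the Rayleigh quotient *)

Section rayleigh.
Variables (K : realType) (n : nat).
Implicit Types (M N : 'M[K]_n.+1) (v w : 'cV[K]_n.+1).

(** Compactness of the unit sphere gives a minimizer on it, and homogeneity of degree 2 extends the
    inequality to every [w]. *)
Lemma rayleigh_minimizer M :
  exists v, sqn v = 1 /\ forall w, qform M v * sqn w <= qform M w.
Proof.
have sqnZ (c : K) w : sqn (c *: w) = c ^+ 2 * sqn w.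
  by rewrite !sqnE mulr_sumr; apply: eq_bigr => k _; rewrite !mxE exprMn.
have qformZ (c : K) w : qform M (c *: w) = c ^+ 2 * qform M w.
  rewrite /qform [(c *: w)^T]linearZ/= -!scalemxAl -scalemxAr !mxE.
  by rewrite mulrA expr2.
pose A := [set u : 'rV[K]_n.+1 | sqn u^T = 1].
have contq (N : 'M[K]_n.+1) : continuous (fun u : 'rV[K]_n.+1 => qform N u^T).
  move=> u; have tr_cont : (x^T @[x --> u]) --> u^T.
    apply/(mx_cvgP (F := nbhs u)) => i j; under eq_fun do rewrite mxE.
    by rewrite mxE; exact: coord_continuous.
  have : ((x^T)^T *m N *m x^T @[x --> u]) --> (u^T)^T *m N *m u^T.
    apply: (cvg_mulmx (F := nbhs u)) => //.
    apply: (cvg_mulmx (F := nbhs u)); last exact: cvg_cst.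
    by under eq_fun do rewrite trmxK; rewrite trmxK; exact: cvg_id.
  by move=> /(mx_cvgP (F := nbhs u)) /(_ 0 0).
have cA : compact A.
  apply: bounded_closed_compact.
    exists 1; split=> // x x1 u /= Au; apply: le_trans (ltW x1).
    rewrite -(mx_norm_tr u).
    rewrite -(@ler_sqr K) ?nnegrE// expr1n -Au; exact: sqr_mx_norm_le_sqn.
  rewrite (_ : A = (fun u : 'rV[K]_n.+1 => qform 1%:M u^T) @^-1` [set 1]).
    by apply: closed_comp => [u _|]; [exact: contq|exact: closed_eq].
  by apply/seteqP; split=> u; rewrite /A /= qform_scalar mul1r.
have A0 : A !=set0.
  exists (delta_mx 0 0); rewrite /A /= trmx_delta sqnE (bigD1 0)//= !mxE !eqxx.
  by rewrite expr1n big1 ?addr0// => l l0; rewrite !mxE (negbTE l0) expr0n.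
have [u uA umin] := compact_EVT_min A0 cA (continuous_subspaceT (contq M)).
exists u^T; split; first by rewrite inE in uA.
move=> w; have [->|w0] := eqVneq w 0.
  by rewrite -(scale0r 0) sqnZ qformZ expr0n/= !mul0r mulr0.
have sw := sqn_gt0 w0.
pose c := (Num.sqrt (sqn w))^-1.
have c2 : c ^+ 2 = (sqn w)^-1 by rewrite exprVn sqr_sqrtr// ltW.
have := umin (c *: w^T); rewrite inE /A/= linearZ/= trmxK sqnZ qformZ c2.
rewrite mulVf ?gt_eqF// => /(_ erefl).
by rewrite mulrC ler_pdivlMr.
Qed.

Definition rayleigh_min_vec M : 'cV[K]_n.+1 := sval (cid (rayleigh_minimizer M)).
(** For symmetric [M] this is the smallest eigenvalue. Defining it as the value of the form at a
    chosen unit vector directly provides the touching functions of the comparison argument. *)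
Definition rayleigh_min M : K := qform M (rayleigh_min_vec M).

Lemma sqn_rayleigh_min_vec M : sqn (rayleigh_min_vec M) = 1.
Proof. by have [] := svalP (cid (rayleigh_minimizer M)). Qed.

Lemma rayleigh_min_le M w : rayleigh_min M * sqn w <= qform M w.
Proof. by have [_] := svalP (cid (rayleigh_minimizer M)); exact. Qed.

Lemma rayleigh_min_ge M c :
  c <= rayleigh_min M <-> forall w, c * sqn w <= qform M w.
Proof.
split=> [cM w|/(_ (rayleigh_min_vec M))]; last by rewrite sqn_rayleigh_min_vec mulr1.
by rewrite (le_trans _ (rayleigh_min_le M w))// ler_wpM2r// sqn_ge0.
Qed.

(** Evaluating [X] at the minimizer of [Y] bounds the difference on one side, and exchanging the two
    bounds it on the other. *)
Lemma rayleigh_min_dist M N :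
  `|rayleigh_min M - rayleigh_min N| <= n.+1%:R ^+ 2 * `|M - N|.
Proof.
have H (X Y : 'M[K]_n.+1) : rayleigh_min X - rayleigh_min Y <= n.+1%:R ^+ 2 * `|X - Y|.
  have := rayleigh_min_le X (rayleigh_min_vec Y).
  rewrite sqn_rayleigh_min_vec mulr1 => ?.
  rewrite (@le_trans _ _ (qform (X - Y) (rayleigh_min_vec Y)))//.
    by rewrite qformB lerB.
  rewrite (le_trans (ler_norm _))// (le_trans (qform_norm _ _))//.
  by rewrite sqn_rayleigh_min_vec mulr1.
by rewrite ler_norml H andbT lerNl opprB distrC H.
Qed.

(* The first variation of the Rayleigh quotient vanishes at a minimizer. *)
Lemma rayleigh_min_vec_eigen M : M^T = M ->
  M *m rayleigh_min_vec M = rayleigh_min M *: rayleigh_min_vec M.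
Proof.
move=> MT; set v := rayleigh_min_vec M; set l := rayleigh_min M.
pose N := M - l%:M.
have NT : N^T = N by rewrite /N linearB/= MT tr_scalar_mx.
have N0 w : 0 <= qform N w.
  by rewrite qformB qform_scalar subr_ge0 rayleigh_min_le.
have Nv : qform N v = 0.
  by rewrite qformB qform_scalar sqn_rayleigh_min_vec mulr1 subrr.
suff : N *m v = 0.
  by rewrite /N mulmxBl mul_scalar_mx => /eqP; rewrite subr_eq0 => /eqP.
pose w := N *m v; apply/eqP/negP => /negP w0.
have sw : 0 < sqn w by exact: sqn_gt0.
have q0 := N0 w.
(* A descent step along [w = N *m v]: with this [t] the form at [v + t *: w] equals
   [t * (sqn w - t)], which is negative. The summand 1 keeps the denominator positive. *)
pose t := - sqn w / (1 + qform N w).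
have q1 : 0 < 1 + qform N w by rewrite ltr_pwDl.
have := N0 (v + t *: w); rewrite qform_add_tr// Nv.
have -> : ((t *: w)^T *m N *m v) 0 0 = t * sqn w.
  by rewrite linearZ/= -!scalemxAl -mulmxA mxE.
have -> : qform N (t *: w) = t ^+ 2 * qform N w.
  rewrite /qform [(t *: w)^T]linearZ/= -!scalemxAl -scalemxAr !mxE.
  by rewrite mulrA expr2.
have tE : t * (1 + qform N w) = - sqn w by rewrite mulfVK// gt_eqF.
have t0 : t < 0 by rewrite ltr_pdivrMr// mul0r oppr_lt0.
rewrite (_ : 0 + 2 * (t * sqn w) + t ^+ 2 * qform N w =
   t * (sqn w + (sqn w + t * (1 + qform N w)) - t)); last by ring.
rewrite tE subrr addr0 leNgt => /negP; apply.
by rewrite nmulr_rlt0// addr_gt0// oppr_gt0.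
Qed.

(** Transfers the blow-up of the spectrum of [P] to its quadratic form: [rayleigh_min M] is itself
    an eigenvalue, and it bounds all eigenvalues from below, so that the infimum is a genuine
    one. *)
Lemma min_spectrum_le_rayleigh_min M : M^T = M -> min_spectrum M <= rayleigh_min M.
Proof.
move=> MT; rewrite /min_spectrum; apply: ge_inf.
  exists (rayleigh_min M) => a /= /eigenvalueP[u uM u0].
  have := rayleigh_min_le M u^T.
  rewrite /qform trmxK uM -scalemxAl mxE -{2}(trmxK u) -/(sqn u^T) ler_pM2r//.
  by apply: sqn_gt0; rewrite trmx_eq0.
apply/eigenvalueP; exists (rayleigh_min_vec M)^T.
  by rewrite -{2}MT -trmx_mul rayleigh_min_vec_eigen// linearZ.
rewrite trmx_eq0; apply: contra_eq_neq (sqn_rayleigh_min_vec M) => ->.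
by rewrite /sqn mulmx0 mxE eq_sym oner_neq0.
Qed.

End rayleigh.

(** * Derivatives of quadratic forms and of inverses *)

Section derivatives.
Variable (K : realType).

Lemma is_derive1_cvgP (V : normedModType K) (f : K -> V) (s : K) (l : V) :
  is_derive s (1 : K) f l <->
  (h^-1 *: (f (h + s) - f s)) @[h --> (0 : K)^'] --> l.
Proof.
have E : (fun h : K => h^-1 *: ((f \o shift s) (h *: (1 : K)) - f s)) =
         (fun h : K => h^-1 *: (f (h + s) - f s)).
  by apply/funext => h /=; rewrite [h *: _]mulr1.
split=> [[df <-]|fl].
  by rewrite /derive E; move: df; rewrite /derivable E.
by apply: DeriveDef; [rewrite /derivable E; apply/cvg_ex; exists l|
  rewrite /derive E; exact/cvg_lim].
Qed.

Lemma is_derive_qform (n : nat) (X : K -> 'M[K]_n) (s : K) (dX : 'M[K]_n)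
    (v : 'cV[K]_n) :
  is_derive s (1 : K) X dX ->
  is_derive s (1 : K) (fun y => qform (X y) v) (qform dX v).
Proof.
move=> /is_derive1_cvgP Xl; apply/is_derive1_cvgP.
have : (v^T *m (h^-1 *: (X (h + s) - X s)) *m v) @[h --> (0 : K)^'] --> v^T *m dX *m v.
  apply: cvg_mulmx; last exact: cvg_cst.
  by apply: cvg_mulmx => //; exact: cvg_cst.
move=> /mx_cvgP /(_ 0 0); apply: cvg_trans; apply: near_eq_cvg; near=> h.
by rewrite -scalemxAr -scalemxAl mxE -qformB.
Unshelve. all: by end_near. Qed.

Lemma is_derive_cvg (V : normedModType K) (f : K -> V) (s : K) (l : V) :
  is_derive s (1 : K) f l -> f (h + s) @[h --> (0 : K)^'] --> f s.
Proof.
move=> /is_derive1_cvgP fl.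
have h0 : h @[h --> (0 : K)^'] --> (0 : K) by exact: cvg_within.
have fs : h *: (h^-1 *: (f (h + s) - f s)) + f s @[h --> (0 : K)^'] --> f s.
  by rewrite -[X in _ --> X]add0r -(scale0r l); apply: cvgD; [exact: cvgZ|exact: cvg_cst].
apply: cvg_trans fs; apply: near_eq_cvg; near=> h.
rewrite /= scalerA mulfV ?scale1r ?subrK//.
by near: h; exact: nbhs_dnbhs_neq.
Unshelve. all: by end_near. Qed.

(** The lower bound, uniform near [s], makes the inverses Lipschitz in [X] and hence continuous at
    [s]; the limit of the difference quotients then follows from [invmx_sub]. *)
Lemma is_derive_invmx (n : nat) (X : K -> 'M[K]_n) (s c : K) (dX : 'M[K]_n) :
  is_derive s (1 : K) X dX ->
  0 < c -> (\near s, forall v, c * sqn v <= qform (X s) v) ->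
  is_derive s (1 : K) (fun y => invmx (X y)) (- (invmx (X s) *m dX *m invmx (X s))).
Proof.
move=> Xd c0 Xc; have Xs v : c * sqn v <= qform (X s) v.
  by have /nbhs_singleton := Xc; exact.
have Xc' : \forall h \near (0 : K)^', forall v, c * sqn v <= qform (X (h + s)) v.
  have hs : (h + s) @[h --> (0 : K)^'] --> s.
    rewrite -[X in _ --> X]add0r; apply: cvgD; last exact: cvg_cst.
    exact: cvg_within.
  exact: (hs _ Xc).
have Xcv := is_derive_cvg Xd.
have Icv : invmx (X (h + s)) @[h --> (0 : K)^'] --> invmx (X s).
  apply/cvgrPdist_lt => e e0.
  pose C := (n%:R / c) ^+ 2 + 1.
  have C0 : 0 < C by rewrite ltr_wpDl// exprn_ge0// divr_ge0// ltW.
  move/cvgrPdist_lt : Xcv => /(_ _ (divr_gt0 e0 C0)) Xcv.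
  near=> h.
  have Xh : forall v, c * sqn v <= qform (X (h + s)) v by near: h.
  apply: (@le_lt_trans _ _ (C * `|X s - X (h + s)|)).
    by rewrite (le_trans (invmx_dist c0 Xs Xh))// ler_wpM2r// lerDl.
  by rewrite mulrC -ltr_pdivlMr//; near: h.
move/is_derive1_cvgP : Xd => Xd; apply/is_derive1_cvgP.
have : - (invmx (X (h + s)) *m (h^-1 *: (X (h + s) - X s)) *m invmx (X s))
   @[h --> (0 : K)^'] --> - (invmx (X s) *m dX *m invmx (X s)).
  by apply: cvgN; apply: cvg_mulmx; [exact: cvg_mulmx|exact: cvg_cst].
apply: cvg_trans; apply: near_eq_cvg; near=> h.
have Xh : forall v, c * sqn v <= qform (X (h + s)) v by near: h.
by rewrite invmx_sub ?(qform_ge_unitmx c0)// scalerN -scalemxAr -scalemxAl.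
Unshelve. all: by end_near. Qed.

End derivatives.

(** * Backward comparison for linear Lyapunov equations *)

Lemma expR_lip (K : realType) (x y M : K) : x <= M -> y <= M ->
  `|expR x - expR y| <= expR M * `|x - y|.
Proof.
move=> xM yM.
have H (u w : K) : u <= M -> expR u - expR w <= expR M * `|u - w|.
  move=> uM; have := expR_ge1Dx (w - u).
  rewrite -(ler_pM2l (expR_gt0 u)) -expRD [u + (w - u)]addrC subrK mulrDr mulr1 => h.
  have h2 : expR u * (u - w) <= expR M * `|u - w|.
    apply: (@le_trans _ _ (expR u * `|u - w|)).
      by rewrite ler_wpM2l ?expR_ge0 ?ler_norm.
    by rewrite ler_wpM2r ?ler_expR.
  have h3 : expR u * (w - u) = - (expR u * (u - w)) by ring.
  by move: h h2; rewrite h3; lra.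
by rewrite ler_norml H// andbT lerNl opprB distrC H.
Qed.

Section lyapunov_comparison.
Variables (K : realType) (n : nat) (a b C kM : K).
Variables (D F G : K -> 'M[K]_n.+1) (k kap : K -> K).
Hypotheses (ab : a <= b) (C0 : 0 <= C) (acD : abs_continuous a b D)
  (symD : forall s, a <= s -> s <= b -> (D s)^T = D s)
  (kap0 : forall s, 0 <= kap s <= kM) (ackap : abs_continuous a b kap)
  (dkap : {ae @lebesgue_measure K, forall s, is_derive s (1 : K) kap (k s)})
  (dD : {ae @lebesgue_measure K, forall s, a < s -> s < b ->
     [/\ is_derive s (1 : K) D (- (D s *m F s + (F s)^T *m D s) - G s),
         `|F s| <= C * k s & forall v, 0 <= qform (G s) v]}).

(** At a unit vector the form of [F s] is at most [n.+1%:R ^+ 2 * C * k s], and [F] occurs twice in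
    the equation of [D]. *)
Let L := 2 * n.+1%:R ^+ 2 * C.

Let L0 : 0 <= L. Proof. by rewrite !mulr_ge0// exprn_ge0. Qed.

Let e (sg s : K) := expR (sg * L * kap s).

Let ac_e sg : abs_continuous a b (e sg).
Proof.
pose M := `|sg * L| * kM.
have bnd s : sg * L * kap s <= M.
  rewrite (le_trans (ler_norm _))// normrM ler_wpM2l//.
  by have /andP[? ?] := kap0 s; rewrite ger0_norm.
apply: (abs_continuous_dominated (C := expR M * `|sg * L|) ackap (abs_continuous_cst a b (0 : K))).
move=> x y _ _ _; rewrite subrr normr0 addr0.
by rewrite (le_trans (expR_lip (bnd y) (bnd x)))// -mulrBr normrM mulrA.
Qed.

Let f s := rayleigh_min (D s).

Let ac_f : abs_continuous a b f.
Proof.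
apply: (abs_continuous_dominated (C := n.+1%:R ^+ 2) acD (abs_continuous_cst a b (0 : K))).
by move=> x y _ _ _; rewrite subrr normr0 addr0 rayleigh_min_dist.
Qed.

Let ac_fe sg : abs_continuous a b (fun s => f s * e sg s).
Proof.
have [M1 M10 fM] := abs_continuous_bounded ac_f.
have [M2 M20 eM] := abs_continuous_bounded (ac_e sg).
apply: (abs_continuous_dominated (C := M1 + M2) ac_f (ac_e sg)).
move=> x y ax xy yb.
have fx : `|f x| <= M1 by rewrite fM// (le_trans xy).
have ey : `|e sg y| <= M2 by rewrite eM// (le_trans ax).
rewrite (_ : f y * e sg y - f x * e sg x =
   (f y - f x) * e sg y + f x * (e sg y - e sg x)); last by ring.
rewrite (le_trans (ler_normD _ _))// !normrM mulrDr !mulrDl.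
have h1 : `|f y - f x| * `|e sg y| <= `|f y - f x| * M2 by rewrite ler_wpM2l.
have h2 : `|f x| * `|e sg y - e sg x| <= M1 * `|e sg y - e sg x| by rewrite ler_wpM2r.
have h3 : 0 <= M1 * `|f y - f x| by rewrite mulr_ge0.
have h4 : 0 <= M2 * `|e sg y - e sg x| by rewrite mulr_ge0.
move: h1 h2 h3 h4; rewrite [_ * M2]mulrC; lra.
Qed.

(** The minimum selects the weight by the sign of [f]: the smaller weight [e (-1)] where [f >= 0],
    and [e 1] where [f < 0]. One absolutely continuous function covers both signs, without following
    the zeros of [f]. *)
Let g s := Num.min (f s * e (-1) s) (f s * e 1 s).

Let ac_g : abs_continuous a b g.
Proof.
apply: (abs_continuous_dominated (C := 1) (ac_fe (-1)) (ac_fe 1)).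
move=> x y _ _ _; rewrite mul1r /g.
move: (f y * _) (f y * _) (f x * _) (f x * _) => p q p' q'.
have H (u u' w w' : K) : Num.min u u' - Num.min w w' <= `|u - w| + `|u' - w'|.
  have := ler_norm (u - w); have := ler_norm (u' - w').
  have := normr_ge0 (u - w); have := normr_ge0 (u' - w').
  by have [?|?] := leP u u'; have [?|?] := leP w w'; lra.
by rewrite ler_norml H andbT lerNl opprB (distrC p) (distrC q) H.
Qed.

(* [g] is touched from above at [s] by [qform (D y) v * e sg y], where [v]
   minimizes the Rayleigh quotient of [D s] and the sign [sg] makes the
   exponential decrease [|f|]. *)
Let g_nonincreasing : g b <= g a.
Proof.
apply: abs_continuous_touch_nonincreasing => //.
have FF := ae_filter_ringOfSetsType (@lebesgue_measure K).
apply: filterS2 dkap dD => s ds Ds as_ sb.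
have {Ds} [Dd Fs Gs] := Ds as_ sb.
have DsT := symD (ltW as_) (ltW sb).
pose v := rayleigh_min_vec (D s).
have v1 : sqn v = 1 by exact: sqn_rayleigh_min_vec.
have Dv : D s *m v = f s *: v by exact: rayleigh_min_vec_eigen.
pose sg : K := if 0 <= f s then -1 else 1.
pose dq := qform (- (D s *m F s + (F s)^T *m D s) - G s) v.
(* As [v] is an eigenvector of the symmetric [D s], the terms [D F] and [F^T D] contribute
   [f s * qform (F s) v] each. *)
have dqE : dq = - (2 * f s * qform (F s) v) - qform (G s) v.
  rewrite /dq qformB qformN qformD.
  have -> : qform (D s *m F s) v = f s * qform (F s) v.
    rewrite /qform -!mulmxA mulmxA -[v^T *m D s]trmxK trmx_mul trmxK DsT Dv.
    by rewrite linearZ/= -scalemxAl mxE !mulmxA.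
  have -> : qform ((F s)^T *m D s) v = f s * qform (F s) v.
    rewrite /qform -!mulmxA Dv -!scalemxAr mxE; congr (_ * _).
    by rewrite -[in RHS](trmxK (v^T *m (F s *m v))) [in RHS]mxE !trmx_mul trmxK mulmxA.
  by ring.
have dqle : dq <= L * k s * `|f s|.
  rewrite dqE; have := Gs v; have := qform_norm (F s) v; rewrite v1 mulr1 => h1 h2.
  have h3 : `|qform (F s) v| <= n.+1%:R ^+ 2 * (C * k s).
    by rewrite (le_trans h1)// ler_wpM2l// exprn_ge0.
  have h4 : - (2 * f s * qform (F s) v) <= 2 * (`|f s| * (n.+1%:R ^+ 2 * (C * k s))).
    rewrite (le_trans (ler_norm _))// normrN 2!normrM ger0_norm// -mulrA.
    by rewrite ler_wpM2l// ler_wpM2l.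
  have -> : L * k s * `|f s| = 2 * (`|f s| * (n.+1%:R ^+ 2 * (C * k s))).
    by rewrite /L; ring.
  by lra.
exists (fun y => qform (D y) v * e sg y).
exists (qform (D s) v *: (e sg s * (sg * L * k s)) + e sg s *: dq); split.
- apply: is_deriveM; first exact: is_derive_qform.
- have -> : qform (D s) v = f s by [].
  have -> : f s *: (e sg s * (sg * L * k s)) + e sg s *: dq =
      e sg s * (sg * f s * (L * k s) + dq) by rewrite /GRing.scale/=; ring.
  rewrite pmulr_rle0 ?expR_gt0//.
  have -> : sg * f s = - `|f s|.
    rewrite /sg; case: ifPn => f0; first by rewrite ger0_norm// mulN1r.
    by rewrite -ltNge in f0; rewrite ltr0_norm// mul1r opprK.
  by move: dqle; rewrite mulNr mulrC; lra.
- rewrite -[qform (D s) v]/(f s) /g /sg.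
  have ele : e (-1) s <= e 1 s.
    rewrite ler_expR mulN1r mul1r mulNr; have /andP[? _] := kap0 s.
    by rewrite (@le_trans _ _ 0)// ?oppr_le0 mulr_ge0.
  case: ifPn => f0; first by rewrite min_l// ler_wpM2l.
  by rewrite -ltNge in f0; rewrite min_r// ler_wnM2l// ltW.
- move=> y sy yb.
  have fy : f y <= qform (D y) v.
    by have := rayleigh_min_le (D y) v; rewrite v1 mulr1.
  have gy : g y <= f y * e sg y.
    by rewrite /g /sg; case: ifP => _; rewrite ge_min lexx ?orbT.
  by rewrite (le_trans gy)// ler_wpM2r// expR_ge0.
Qed.

Let e_ge1 s : 1 <= e 1 s <= expR (L * kM).
Proof.
have /andP[? ?] := kap0 s; rewrite /e mul1r ler_expR ler_wpM2l// andbT.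
by rewrite -expR0 ler_expR mulr_ge0.
Qed.

Let e_le1 s : expR (- (L * kM)) <= e (-1) s <= 1.
Proof.
have /andP[? ?] := kap0 s; rewrite /e mulN1r mulNr ler_expR lerN2 ler_wpM2l//=.
by rewrite -expR0 ler_expR oppr_le0 mulr_ge0.
Qed.

(** Read off from [g b <= g a] and the bounds on the weights. With [c = 0] the sign of [D] passes
    from [b] to [a]; with [c > 0] so does definiteness, with an explicit loss. *)
Lemma lyapunov_lower_bound c : 0 <= c ->
  (forall v, c * sqn v <= qform (D b) v) ->
  forall v, c * expR (- (L * kM)) * sqn v <= qform (D a) v.
Proof.
move=> c0 /rayleigh_min_ge cb; apply/rayleigh_min_ge.
have /andP[e1 _] := e_ge1 b; have /andP[e2 e3] := e_le1 b; have /andP[_ e4] := e_le1 a.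
have ga : c * expR (- (L * kM)) <= g a.
  apply: le_trans g_nonincreasing; rewrite /g le_min; apply/andP; split.
    by rewrite ler_pM// expR_ge0.
  by rewrite ler_pM ?expR_ge0// (le_trans e2)// (le_trans e3).
have : c * expR (- (L * kM)) <= f a * e (-1) a.
  by rewrite (le_trans ga)// /g ge_min lexx.
move=> fa; have fa0 : 0 <= f a.
  by rewrite -(pmulr_lge0 _ (expR_gt0 (-1 * L * kap a))) (le_trans _ fa)// mulr_ge0// expR_ge0.
by rewrite (le_trans fa)// ler_piMr.
Qed.

(** The counterpart for [D] of unknown sign: a negative lower bound worsens by at most the largest
    weight. Applied to a difference and to its opposite, it yields a norm estimate. *)
Lemma lyapunov_lower_boundN c : 0 <= c ->
  (forall v, - c * sqn v <= qform (D b) v) ->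
  forall v, - (c * expR (L * kM)) * sqn v <= qform (D a) v.
Proof.
move=> c0 /rayleigh_min_ge cb; apply/rayleigh_min_ge.
have /andP[e1 e5] := e_ge1 b; have /andP[e2 e3] := e_le1 b; have /andP[e4 e6] := e_ge1 a.
have H sg : 0 <= e sg b -> e sg b <= expR (L * kM) ->  - (c * expR (L * kM)) <= f b * e sg b.
  move=> h0 h1; rewrite (@le_trans _ _ (- c * e sg b))//.
    by rewrite mulNr lerN2 ler_wpM2l.
  by rewrite ler_wpM2r.
have ga : - (c * expR (L * kM)) <= g a.
  apply: le_trans g_nonincreasing; rewrite /g le_min; apply/andP; split; apply: H => //.
  - exact: expR_ge0.
  - by rewrite (le_trans e3)// (le_trans e1).
  - exact: expR_ge0.
have fa : - (c * expR (L * kM)) <= f a * e 1 a.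
  by rewrite (le_trans ga)// /g ge_min lexx orbT.
rewrite leNgt; apply/negP => h.
have fa0 : f a <= 0.
  by rewrite (le_trans (ltW h))// oppr_le0 mulr_ge0// expR_ge0.
have : f a * e 1 a <= f a by rewrite -{2}[f a]mulr1 ler_wnM2l.
by move=> h2; have := le_lt_trans (le_trans fa h2) h; rewrite ltxx.
Qed.

End lyapunov_comparison.

(** * Integrable domination of the coefficients *)

Lemma Lfun1_sum (K : realType) (I : finType) (f : I -> K -> K) :
  (forall i, f i \in Lfun (@lebesgue_measure K) 1) ->
  (fun s => \sum_i f i s) \in Lfun (@lebesgue_measure K) 1.
Proof.
move=> fL; apply/Lfun1_integrable.
have -> : EFin \o (fun s => \sum_i f i s) = (fun s => \sum_i (f i s)%:E)%E.
  by apply/funext => s /=; rewrite sumEFin.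
by apply: integrable_sum => // i _; have /Lfun1_integrable := fL i.
Qed.

(** Take for [k] the sum of the absolute values of the entries of [A] and [Q] and of the squares of
    the entries of [B]. The squares are there because [B R^-1 B^T] is quadratic in [B]; they are
    integrable as [B] is in L^2. *)
Lemma Lp_mx_dominated (K : realType) (n m : nat) (T : K)
    (A : K -> 'M[K]_n) (B : K -> 'M[K]_(n, m)) (Q : K -> 'M[K]_n) :
  Lp_mx 1%:E 0 T A -> Lp_mx 2%:E 0 T B -> Lp_mx 1%:E 0 T Q ->
  exists k : K -> K,
  [/\ k \in Lfun (@lebesgue_measure K) 1, forall s, 0 <= k s &
    forall s, 0 < s -> s < T -> [/\ `|A s| <= k s, `|B s| ^+ 2 <= k s & `|Q s| <= k s]].
Proof.
move=> LA LB LQ.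
pose nA ij s := `|((fun s => A s ij.1 ij.2) \_ `]0, T[) s|.
pose nB (ij : 'I_n * 'I_m) s := ((fun s => B s ij.1 ij.2) \_ `]0, T[) s ^+ 2.
pose nQ ij s := `|((fun s => Q s ij.1 ij.2) \_ `]0, T[) s|.
pose N (x : 'I_n * 'I_n + 'I_n * 'I_m + 'I_n * 'I_n) : K -> K :=
  match x with inl (inl ij) => nA ij | inl (inr ij) => nB ij | inr ij => nQ ij end.
have N0 x s : 0 <= N x s.
  by case: x => [[ij|ij]|ij] /=; rewrite ?normr_ge0// sqr_ge0.
have N_le x s : N x s <= \sum_y N y s.
  by rewrite (bigD1 x)//= lerDl sumr_ge0.
exists (fun s => \sum_x N x s); split.
- apply: Lfun1_sum => -[[ij|ij]|ij] /=.
  + exact: (Lfun_norm (LA ij.1 ij.2)).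
  + apply/Lfun1_integrable; exact: Lfun2_integrable_sqr (LB ij.1 ij.2).
  + exact: (Lfun_norm (LQ ij.1 ij.2)).
- by move=> s; rewrite sumr_ge0.
- move=> s s0 sT.
  have sI : s \in `]0, T[%classic by rewrite inE/= in_itv/= s0.
  have k0 : 0 <= \sum_x N x s by rewrite sumr_ge0.
  split.
  + apply: mx_norm_le => // i j; apply: le_trans (N_le (inl (inl (i, j))) s).
    by rewrite /= /nA patchE sI.
  + rewrite -[leRHS]sqr_sqrtr// ler_sqr ?nnegrE ?sqrtr_ge0//.
    apply: mx_norm_le => [|i j]; first exact: sqrtr_ge0.
    rewrite -ler_sqr ?nnegrE ?sqrtr_ge0// sqr_sqrtr//.
    apply: le_trans (N_le (inl (inr (i, j))) s).
    by rewrite /= /nB patchE sI real_normK ?num_real.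
  + apply: mx_norm_le => // i j; apply: le_trans (N_le (inr (i, j)) s).
    by rewrite /= /nQ patchE sI.
Qed.

(** * Comparison of two Riccati solutions and of their inverses *)

Section riccati_comparison.
Variables (K : realType) (n : nat) (T cS kM : K).
Variables (A Q S : K -> 'M[K]_n.+1) (k kap : K -> K).
Implicit Types (a b c d : K) (X Y : K -> 'M[K]_n.+1).
Hypotheses (cS0 : 0 <= cS) (kap0 : forall s, 0 <= kap s <= kM)
  (ackap : forall a b, abs_continuous a b kap)
  (dkap : {ae @lebesgue_measure K, forall s, is_derive s (1 : K) kap (k s)})
  (coef : {ae @lebesgue_measure K, forall s, 0 < s -> s < T ->
     [/\ `|A s| <= k s, `|S s| <= cS * k s, (S s)^T = S s &
      [/\ `|Q s| <= k s, (Q s)^T = Q s & forall v, 0 <= qform (Q s) v]]}).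

(** [S] stands for [B R^-1 B^T]. Compact intervals let one notion serve each [P_i] on [[0, T]] and
    [P] on every [[0, b]] with [b < T]. *)
Definition riccati_on (a b : K) (X : K -> 'M[K]_n.+1) : Prop :=
  [/\ abs_continuous a b X, forall s, a <= s -> s <= b -> (X s)^T = X s &
   {ae @lebesgue_measure K, forall s, a < s -> s < b -> is_derive s (1 : K) X
     (- (X s *m A s + (A s)^T *m X s + Q s - X s *m S s *m X s))}].

Lemma riccati_onS a b c d X : c <= a -> b <= d -> riccati_on c d X -> riccati_on a b X.
Proof.
move=> ca bd [acX symX dX]; split; first exact: abs_continuousS acX.
  by move=> s as_ sb; apply: symX; [exact: le_trans as_|exact: le_trans bd].
have FF := ae_filter_ringOfSetsType (@lebesgue_measure K).
apply: filterS dX => s h as_ sb; apply: h; first exact: le_lt_trans as_.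
exact: lt_le_trans bd.
Qed.

(** With the mean of [X] and [Y] in the coefficient [F], the cross terms [Y S X] and [X S Y] cancel
    and exactly [Y S Y - X S X] remains. *)
Lemma riccati_le a b X Y : 0 <= a -> a <= b -> b <= T ->
  riccati_on a b X -> riccati_on a b Y ->
  (forall v, qform (X b) v <= qform (Y b) v) ->
  forall v, qform (X a) v <= qform (Y a) v.
Proof.
move=> a0 ab bT [acX symX dX] [acY symY dY] XYb v.
have [MX MX0 XM] := abs_continuous_bounded acX.
have [MY MY0 YM] := abs_continuous_bounded acY.
(* The summand 1 accounts for [A], the rest for [S (X + Y)], with its factor 1/2 majorized by 1. *)
pose C := 1 + n.+1%:R * cS * (MX + MY).
have C0 : 0 <= C by rewrite addr_ge0// !mulr_ge0// addr_ge0.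
have acD : abs_continuous a b (fun s => Y s - X s).
  apply: (abs_continuous_dominated (C := 1) acY acX) => x y _ _ _.
  rewrite mul1r (_ : Y y - X y - (Y x - X x) = (Y y - Y x) - (X y - X x)).
    exact: ler_normB.
  by rewrite !opprB addrACA [RHS]addrACA [- X y - _]addrC.
rewrite -subr_ge0 -qformB.
suff : 0 * expR (- (2 * n.+1%:R ^+ 2 * C * kM)) * sqn v <= qform (Y a - X a) v.
  by rewrite !mul0r.
apply: (@lyapunov_lower_bound K n a b C kM (fun s => Y s - X s)
  (fun s => A s - 2^-1 *: (S s *m (X s + Y s))) (fun=> 0) k kap) => //.
- by move=> s as_ sb; rewrite linearB/= symX// symY.
- have FF := ae_filter_ringOfSetsType (@lebesgue_measure K).
  apply: filterS3 coef dX dY => s cs dXs dYs as_ sb.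
  have [] := cs (le_lt_trans a0 as_) (lt_le_trans sb bT).
  move=> Ak Sk ST [Qk QT Q0].
  have sa := ltW as_; have sb' := ltW sb.
  split; last by move=> w; rewrite qform0.
  + have := is_deriveB (dYs as_ sb) (dXs as_ sb).
    congr (is_derive _ _ _ _).
    have -> : (A s - 2^-1 *: (S s *m (X s + Y s)))^T =
        (A s)^T - 2^-1 *: ((X s + Y s) *m S s).
      rewrite [LHS]linearB/= [X in _ - X = _]linearZ/= trmx_mul ST.
      by rewrite [(X s + Y s)^T]linearD/= (symX _ sa sb') (symY _ sa sb').
    rewrite subr0.
    rewrite !mulmxBr !mulmxBl -!scalemxAr -!scalemxAl !mulmxDl !mulmxDr.
    rewrite !mulmxA.
    move: (Y s *m A s) (X s *m A s) ((A s)^T *m Y s) ((A s)^T *m X s)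
      (Y s *m S s *m Y s) (Y s *m S s *m X s) (X s *m S s *m Y s) (X s *m S s *m X s)
      (Q s) => m1 m2 m3 m4 m5 m6 m7 m8 m9.
    by apply/matrixP => i j; rewrite !mxE; field.
  + rewrite (le_trans (ler_normB _ _))// normrZ ger0_norm ?invr_ge0//.
    rewrite /C mulrDl mul1r lerD//.
    apply: (@le_trans _ _ (1 * `|S s *m (X s + Y s)|)).
      by rewrite ler_wpM2r// invf_le1// ler1n.
    rewrite mul1r (le_trans (mx_norm_mul _ _))//.
    rewrite (_ : n.+1%:R * cS * (MX + MY) * k s = n.+1%:R * (cS * k s) * (MX + MY)); last by ring.
    rewrite ler_pM ?mulr_ge0//; first by rewrite ler_wpM2l.
    by rewrite (le_trans (ler_normD _ _))// lerD// ?XM// YM.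
- by move=> w; rewrite mul0r qformB subr_ge0.
Qed.

(** [X] itself solves a Lyapunov equation, with [F = A - S X / 2] and forcing term [Q], whose sign
    only helps backwards in time. *)
Lemma riccati_uniform_posdef X c : 0 <= T -> riccati_on 0 T X -> 0 < c ->
  (forall v, c * sqn v <= qform (X T) v) ->
  exists2 c', 0 < c' & forall s, 0 <= s -> s <= T -> forall v, c' * sqn v <= qform (X s) v.
Proof.
move=> T0 solX c0 XT; have [acX symX dX] := solX.
have [MX MX0 XM] := abs_continuous_bounded acX.
pose C := 1 + n.+1%:R * cS * MX.
have C0 : 0 <= C by rewrite addr_ge0// !mulr_ge0// addr_ge0.
exists (c * expR (- (2 * n.+1%:R ^+ 2 * C * kM))); first by rewrite mulr_gt0// expR_gt0.
move=> t t0 tT.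
have [acXt symXt dXt] := riccati_onS t0 (lexx T) solX.
apply: (@lyapunov_lower_bound K n t T C kM X
  (fun s => A s - 2^-1 *: (S s *m X s)) Q k kap) => //; last exact: ltW.
have FF := ae_filter_ringOfSetsType (@lebesgue_measure K).
apply: filterS2 coef dXt => s cs dXs as_ sb.
have [] := cs (le_lt_trans t0 as_) sb.
move=> Ak Sk ST [Qk QT Q0].
have sa := ltW as_; have sb' := ltW sb.
split => //.
- have := dXs as_ sb; congr (is_derive _ _ _ _).
  have -> : (A s - 2^-1 *: (S s *m X s))^T = (A s)^T - 2^-1 *: (X s *m S s).
    rewrite [LHS]linearB/= [X in _ - X = _]linearZ/= trmx_mul ST.
    by rewrite (symXt _ sa sb').
  rewrite !mulmxBr !mulmxBl -!scalemxAr -!scalemxAl !mulmxA.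
  move: (X s *m A s) ((A s)^T *m X s) (X s *m S s *m X s) (Q s) => m1 m2 m3 m4.
  by apply/matrixP => i j; rewrite !mxE; field.
- rewrite (le_trans (ler_normB _ _))// normrZ ger0_norm ?invr_ge0//.
  rewrite /C mulrDl mul1r lerD//.
  apply: (@le_trans _ _ (1 * `|S s *m X s|)).
    by rewrite ler_wpM2r// invf_le1// ler1n.
  rewrite mul1r (le_trans (mx_norm_mul _ _))//.
  rewrite (_ : n.+1%:R * cS * MX * k s = n.+1%:R * (cS * k s) * MX); last by ring.
  rewrite ler_pM ?mulr_ge0//; first by rewrite ler_wpM2l.
  by rewrite XM// (le_trans t0).
Qed.

(** Inversion exchanges the roles of [Q] and [S]: [S] becomes an additive term, which drops out of
    the difference of two inverses, and [Q] becomes the quadratic coefficient. *)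
Lemma riccati_invmx_rhs (X A0 Q0 S0 : 'M[K]_n.+1) : X \in unitmx ->
  - (invmx X *m - (X *m A0 + A0^T *m X + Q0 - X *m S0 *m X) *m invmx X) =
  A0 *m invmx X + invmx X *m A0^T + invmx X *m Q0 *m invmx X - S0.
Proof.
move=> uX; rewrite mulmxN mulNmx opprK !(mulmxBr, mulmxDr) !(mulmxBl, mulmxDl).
by rewrite !mulmxA mulVmx// !mul1mx mulNmx -!mulmxA mulmxV// !mulmx1 !mulmxA.
Qed.

(** The difference of the inverses has coefficient [F = - (A^T + Q M)], with [M] the mean of the
    inverses. As [M] is at most [c^-1], the bound on [F] does not depend on the size of [X] and [Y],
    which may be huge near [T]. *)
Lemma riccati_invmx_lower a b X Y c : 0 <= a -> a <= b -> b <= T ->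
  riccati_on a b X -> riccati_on a b Y -> 0 < c ->
  (forall s, a <= s -> s <= b -> forall v, c * sqn v <= qform (X s) v) ->
  (forall s, a <= s -> s <= b -> forall v, c * sqn v <= qform (Y s) v) ->
  forall v, - (n.+1%:R ^+ 2 * `|invmx (Y b) - invmx (X b)| *
      expR (2 * n.+1%:R ^+ 2 * (1 + n.+1%:R / c) * kM)) * sqn v <=
    qform (invmx (Y a) - invmx (X a)) v.
Proof.
move=> a0 ab bT [acX symX dX] [acY symY dY] c0 Xc Yc.
have aci (Z : K -> 'M[K]_n.+1) : abs_continuous a b Z ->
    (forall s, a <= s -> s <= b -> forall v, c * sqn v <= qform (Z s) v) ->
    abs_continuous a b (fun s => invmx (Z s)).
  move=> acZ Zc; apply: (abs_continuous_dominated (C := (n.+1%:R / c) ^+ 2) acZ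
    (abs_continuous_cst a b (0 : K))) => x y ax xy yb.
  rewrite subrr normr0 addr0 /=; apply: (invmx_dist c0).
  - by apply: Zc => //; exact: le_trans xy.
  - by apply: Zc => //; exact: le_trans yb.
have acD : abs_continuous a b (fun s => invmx (Y s) - invmx (X s)).
  apply: (abs_continuous_dominated (C := 1) (aci _ acY Yc) (aci _ acX Xc)) => x y _ _ _.
  rewrite mul1r (_ : _ - _ = (invmx (Y y) - invmx (Y x)) - (invmx (X y) - invmx (X x))).
    exact: ler_normB.
  by rewrite !opprB addrACA [RHS]addrACA [- invmx (X y) - _]addrC.
have ic0 : 0 <= n.+1%:R / c by rewrite divr_ge0// ltW.
pose M s := 2^-1 *: (invmx (Y s) + invmx (X s)).
apply: (@lyapunov_lower_boundN K n a b (1 + n.+1%:R / c) kM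
  (fun s => invmx (Y s) - invmx (X s))
  (fun s => - ((A s)^T + Q s *m M s)) (fun=> 0) k kap) => //.
- by rewrite addr_ge0.
- by move=> s as_ sb; rewrite linearB/= !trmx_inv symX// symY.
- have FF := ae_filter_ringOfSetsType (@lebesgue_measure K).
  apply: filterS3 coef dX dY => s cs dXs dYs as_ sb.
  have [] := cs (le_lt_trans a0 as_) (lt_le_trans sb bT).
  move=> Ak Sk ST [Qk QT Q0].
  have sa := ltW as_; have sb' := ltW sb.
  have uX := qform_ge_unitmx c0 (Xc _ sa sb').
  have uY := qform_ge_unitmx c0 (Yc _ sa sb').
  have nears (P : K -> Prop) : (forall y, a <= y -> y <= b -> P y) -> \near s, P s.
    move=> Py; have : s \in `]a, b[ by rewrite in_itv/= as_.
    move=> /near_in_itvoo; apply: filterS => y /=; rewrite in_itv/= => /andP[? ?].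
    by apply: Py; exact: ltW.
  split; last by move=> w; rewrite qform0.
  + have := is_deriveB (is_derive_invmx (dYs as_ sb) c0 (nears _ Yc))
      (is_derive_invmx (dXs as_ sb) c0 (nears _ Xc)).
    congr (is_derive _ _ _ _).
    rewrite !riccati_invmx_rhs//.
    have -> : (- ((A s)^T + Q s *m M s))^T = - (A s + M s *m Q s).
      rewrite [LHS]linearN/= [X in - X = _]linearD/= trmxK trmx_mul QT.
      rewrite /M [(2^-1 *: _)^T]linearZ/= [(_ + _)^T]linearD/= !trmx_inv.
      by rewrite (symX _ sa sb') (symY _ sa sb').
    rewrite subr0 /M mulmxN mulNmx.
    rewrite -!scalemxAr -!scalemxAl !mulmxDr !mulmxDl -!scalemxAr -!scalemxAl.
    rewrite !(mulmxDr, mulmxDl, mulmxBr, mulmxBl) !(mulNmx, mulmxN) !mulmxA.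
    move: (A s *m invmx (Y s)) (A s *m invmx (X s)) (invmx (Y s) *m (A s)^T)
      (invmx (X s) *m (A s)^T) (invmx (Y s) *m Q s *m invmx (Y s))
      (invmx (Y s) *m Q s *m invmx (X s)) (invmx (X s) *m Q s *m invmx (Y s))
      (invmx (X s) *m Q s *m invmx (X s)) (S s) => m1 m2 m3 m4 m5 m6 m7 m8 m9.
    by apply/matrixP => i j; rewrite !mxE; field.
  + rewrite normrN (le_trans (ler_normD _ _))// mx_norm_tr mulrDl mul1r lerD//.
    rewrite (le_trans (mx_norm_mul _ _))//.
    rewrite (_ : n.+1%:R / c * k s = n.+1%:R * k s * c^-1); last by ring.
    rewrite ler_pM ?mulr_ge0//; first by rewrite ler_wpM2l.
    rewrite /M normrZ ger0_norm ?invr_ge0// mulrC ler_pdivrMr// mulr_natr mulr2n.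
    by rewrite (le_trans (ler_normD _ _))// lerD// qform_ge_invmx_norm//; auto.
- move=> w; have := qform_norm (invmx (Y b) - invmx (X b)) w.
  by rewrite ler_norml mulNr => /andP[].
Qed.

Lemma riccati_invmx_dist a b X Y c : 0 <= a -> a <= b -> b <= T ->
  riccati_on a b X -> riccati_on a b Y -> 0 < c ->
  (forall s, a <= s -> s <= b -> forall v, c * sqn v <= qform (X s) v) ->
  (forall s, a <= s -> s <= b -> forall v, c * sqn v <= qform (Y s) v) ->
  `|invmx (Y a) - invmx (X a)| <=
    n.+1%:R ^+ 2 * `|invmx (Y b) - invmx (X b)| *
      expR (2 * n.+1%:R ^+ 2 * (1 + n.+1%:R / c) * kM).
Proof.
move=> a0 ab bT sX sY c0 Xc Yc; have [_ symX _] := sX; have [_ symY _] := sY.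
apply: mx_norm_qform_le.
- by rewrite !mulr_ge0 ?exprn_ge0// expR_ge0.
- by rewrite linearB/= !trmx_inv symX// symY.
- move=> v; rewrite ler_norml -mulNr (riccati_invmx_lower a0 ab bT sX sY c0)//=.
  (* The upper bound is the lower bound with [X] and [Y] exchanged. *)
  rewrite -lerN2 -qformN opprB -mulNr distrC.
  exact: (riccati_invmx_lower a0 ab bT sY sX c0).
Qed.

(** * The sequence [Pi] and its limit [P] *)

Variables (Pi : nat -> K -> 'M[K]_n.+1) (P : K -> 'M[K]_n.+1).
Hypotheses (T0 : 0 < T)
  (solPi : forall i, (1 <= i)%N -> riccati_on 0 T (Pi i))
  (PiT : forall i, (1 <= i)%N -> Pi i T = (i%:R)%:M)
  (solP : forall b, 0 <= b -> b < T -> riccati_on 0 b P)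
  (blowup : forall c t, t < T ->
     exists s, [/\ t < s, s < T & forall v, c * sqn v <= qform (P s) v]).

Lemma riccati_seq_nondecreasing i t v : (1 <= i)%N -> 0 <= t -> t <= T ->
  qform (Pi i t) v <= qform (Pi i.+1 t) v.
Proof.
move=> i1 t0 tT; apply: (@riccati_le t T) => //.
- exact: riccati_onS (solPi i1).
- exact: riccati_onS (solPi (leqW i1)).
- by move=> w; rewrite !PiT// ?leqW// !qform_scalar ler_wpM2r ?sqn_ge0// ler_nat.
Qed.

(** [Pi i] is bounded on [[0, T]], so the blow-up provides a time [s] after [t] at which [P]
    dominates it; the order then propagates back from [s] to [t]. *)
Lemma riccati_seq_le_limit i t v : (1 <= i)%N -> 0 <= t -> t < T ->
  qform (Pi i t) v <= qform (P t) v.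
Proof.
move=> i1 t0 tT; have [acPi _ _] := solPi i1.
have [M M0 PiM] := abs_continuous_bounded acPi.
have [s [ts sT Ps]] := blowup (n.+1%:R ^+ 2 * M) tT.
have s0 := le_trans t0 (ltW ts).
apply: (@riccati_le t s) => //; [exact: ltW|exact: ltW| | |].
- by apply: riccati_onS (solPi i1) => //; exact: ltW.
- exact: riccati_onS (solP s0 sT).
- move=> w; apply: le_trans (Ps w); rewrite (le_trans (ler_norm _))//.
  rewrite (le_trans (qform_norm _ _))// ler_wpM2r ?sqn_ge0// ler_wpM2l ?exprn_ge0//.
  by rewrite PiM// ltW.
Qed.

(** Monotonicity in [i] reduces the bound to [Pi 1], which is the identity at [T]. *)
Lemma riccati_seq_uniform_posdef : exists2 c, 0 < c &
  forall i s, (1 <= i)%N -> 0 <= s -> s <= T -> forall v, c * sqn v <= qform (Pi i s) v.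
Proof.
have [||c c0 P1c] := @riccati_uniform_posdef (Pi 1%N) 1 (ltW T0) (solPi (leqnn 1)).
- exact: ltr01.
- by move=> v; rewrite PiT// qform_scalar.
exists c => // + s + s0 sT v; elim=> // -[_ _|i IH _]; first exact: P1c.
by rewrite (le_trans (IH isT))// riccati_seq_nondecreasing.
Qed.

Lemma riccati_seq_norm_le i t : (1 <= i)%N -> 0 <= t -> t < T ->
  `|Pi i t| <= n.+1%:R ^+ 2 * `|P t|.
Proof.
move=> i1 t0 tT; have [c c0 Pic] := riccati_seq_uniform_posdef.
have [_ symPi _] := solPi i1.
apply: mx_norm_qform_le; [by rewrite mulr_ge0 ?exprn_ge0|by apply: symPi => //; exact: ltW|].
move=> v; rewrite ger0_norm.
  rewrite (le_trans (riccati_seq_le_limit v i1 t0 tT))//.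
  by rewrite (le_trans (ler_norm _))// qform_norm.
apply: le_trans (Pic _ _ i1 t0 (ltW tT) v).
by rewrite mulr_ge0 ?sqn_ge0// ltW.
Qed.

(* The inverses of [Pi i] and [P] both become small near [T], and their
   difference solves a linear equation with coefficients bounded independently
   of [i] and integrable up to [T]. *)
Lemma riccati_seq_cvg t : 0 <= t -> t < T -> Pi i t @[i --> \oo] --> P t.
Proof.
move=> t0 tT; have [c c0 Pic] := riccati_seq_uniform_posdef.
have Pc s : 0 <= s -> s < T -> forall v, c * sqn v <= qform (P s) v.
  move=> s0 sT v; apply: le_trans (Pic 1%N s isT s0 (ltW sT) v) _.
  exact: riccati_seq_le_limit.
pose E := expR (2 * n.+1%:R ^+ 2 * (1 + n.+1%:R / c) * kM).
(* The leading square comes from two matrix products; the other factors bound [Pi i t], [i] times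
   the distance of the inverses at [t], and [P t]. *)
pose N := n.+1%:R ^+ 2 * (n.+1%:R ^+ 2 * `|P t|) * (n.+1%:R ^+ 2 * 4 * E) * `|P t|.
have E0 : 0 <= E by exact: expR_ge0.
have dist i : (1 <= i)%N -> `|P t - Pi i t| <= N / i%:R.
  move=> i1; have i0 : 0 < i%:R :> K by rewrite ltr0n.
  have n2 : 0 < n.+1%:R ^+ 2 :> K by rewrite exprn_gt0.
  have [acPi _ _] := solPi i1.
  (* Within this distance of [Pi i T], which is [i] times the identity, the form of [Pi i] loses at
     most [i / 2]. *)
  have e0 : 0 < i%:R / 2 / n.+1%:R ^+ 2 :> K by rewrite !divr_gt0.
  have [d d0 dP] := abs_continuous_diff acPi e0.
  have tT' : Num.max t (T - d) < T by rewrite gt_max tT ltrBlDr ltrDl.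
  (* At this [s] both [Pi i s] and [P s] dominate [i / 2], so each inverse has norm at most
     [2 / i]. *)
  have [s [+ sT Ps]] := blowup (i%:R / 2) tT'.
  rewrite gt_max => /andP[ts ds].
  have s0 := le_trans t0 (ltW ts).
  have i20 : 0 < i%:R / 2 :> K by rewrite divr_gt0.
  have Pis v : i%:R / 2 * sqn v <= qform (Pi i s) v.
    have := dP s T s0 (ltW sT) (lexx T); rewrite ltrBlDr -ltrBlDl => /(_ ds) h.
    have h1 := qform_norm (Pi i T - Pi i s) v.
    have h2 : n.+1%:R ^+ 2 * `|Pi i T - Pi i s| * sqn v <= i%:R / 2 * sqn v.
      rewrite ler_wpM2r ?sqn_ge0// mulrC -ler_pdivlMr//; exact: ltW.
    move: h1 h2; rewrite PiT// qformB qform_scalar ler_norml => /andP[_] + +.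
    have : i%:R * sqn v = i%:R / 2 * sqn v + i%:R / 2 * sqn v.
      by rewrite -mulrDl -splitr.
    by lra.
  have Dt : `|invmx (P t) - invmx (Pi i t)| <= n.+1%:R ^+ 2 * 4 * E / i%:R.
    apply: (le_trans (riccati_invmx_dist (b := s) t0 (ltW ts) (ltW sT) _ _ c0 _ _)).
    - by apply: riccati_onS (solPi i1) => //; exact: ltW.
    - exact: riccati_onS (solP s0 sT).
    - move=> r tr rs; apply: Pic => //; first exact: le_trans tr.
      exact: le_trans (ltW sT).
    - move=> r tr rs; apply: Pc; first exact: le_trans tr.
      exact: le_lt_trans sT.
    rewrite -/E [leRHS](_ : _ = n.+1%:R ^+ 2 * (4 / i%:R) * E); last by ring.
    rewrite ler_wpM2r// ler_wpM2l ?exprn_ge0//.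
    have -> : 4 / i%:R = (i%:R / 2)^-1 + (i%:R / 2)^-1 :> K.
      by field; rewrite gt_eqF.
    by rewrite (le_trans (ler_normB _ _))// lerD// qform_ge_invmx_norm.
  have uP := qform_ge_unitmx c0 (Pc _ t0 tT).
  have uPi := qform_ge_unitmx c0 (Pic _ _ i1 t0 (ltW tT)).
  (* The estimate is carried back from the inverses to the matrices at the fixed time [t], where
     [Pi i t] is bounded in terms of [P t]. *)
  have -> : P t - Pi i t = - (Pi i t *m (invmx (P t) - invmx (Pi i t)) *m P t).
    by rewrite mulmxBr mulmxBl mulmxV// mul1mx -mulmxA mulVmx// mulmx1 opprB.
  rewrite normrN (le_trans (mx_norm_mul _ _))//.
  apply: (@le_trans _ _ (n.+1%:R * (n.+1%:R * (n.+1%:R ^+ 2 * `|P t|) *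
     (n.+1%:R ^+ 2 * 4 * E / i%:R)) * `|P t|)).
    rewrite ler_wpM2r// ler_wpM2l// (le_trans (mx_norm_mul _ _))//.
    by rewrite ler_pM ?mulr_ge0// ler_wpM2l// riccati_seq_norm_le.
  by rewrite le_eqVlt; apply/orP; left; apply/eqP; rewrite /N; ring.
apply/cvgrPdist_le => e e0; near=> i.
have i1 : (1 <= i)%N by near: i; exact: nbhs_infty_ge.
have i0 : 0 < i%:R :> K by rewrite ltr0n.
apply: le_trans (dist i i1) _.
rewrite ler_pdivrMr// mulrC -ler_pdivrMr//.
by near: i; exact: nbhs_infty_ger.
Unshelve. all: by end_near. Qed.

End riccati_comparison.

(** * Reduction of the theorem to the comparison results *)

Theorem mainTheorem4 (K : realType) (n m : nat) (T : K)
    (A : K -> 'M[K]_n) (B : K -> 'M[K]_(n, m))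
    (Q : K -> 'M[K]_n) (R : K -> 'M[K]_m) (delta : K)
    (Pi : nat -> K -> 'M[K]_n) (P : K -> 'M[K]_n)
    (T_gt0 : 0 < T)
    (A_L1 : Lp_mx 1%:E 0 T A)
    (B_L2 : Lp_mx 2%:E 0 T B)
    (ctrl : completely_controllable T A B)
    (Q_L1 : Lp_mx 1%:E 0 T Q)
    (Q_ge0 : {ae @lebesgue_measure K, forall s, `]0, T[%classic s ->
       Q s \is symmetricmx /\ loewner_le 0 (Q s)})
    (R_Loo : Lp_mx +oo%E 0 T R)
    (delta_gt0 : 0 < delta)
    (R_ge : {ae @lebesgue_measure K, forall s, `]0, T[%classic s ->
       R s \is symmetricmx /\ loewner_le delta%:M (R s)})
    (Pi_sym : forall i s, (1 <= i)%N -> 0 <= s -> s <= T ->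
       Pi i s \is symmetricmx)
    (Pi_sol : forall i, (1 <= i)%N -> riccati_sol A B Q R `[0, T] (Pi i))
    (Pi_T : forall i, (1 <= i)%N -> Pi i T = (i%:R)%:M)
    (P_pd : forall s, 0 <= s -> s < T -> posdef (P s))
    (P_sol : riccati_sol A B Q R `[0, T[ P)
    (P_T : min_spectrum (P s) @[s --> T^'-] --> +oo) :
  (forall t, 0 <= t -> t < T ->
     (forall i, (1 <= i)%N -> loewner_le (Pi i t) (Pi i.+1 t)) /\
     Pi i t @[i --> \oo] --> P t) /\
  (forall a b : K, `[a, b] `<=` `[0, T[ ->
     exists M : K, forall i s, (1 <= i)%N -> a <= s -> s <= b ->
       `|Pi i s| <= M).
Proof.
have FF := ae_filter_ringOfSetsType (@lebesgue_measure K).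
(* Dimension 0 has no unit vector, hence no Rayleigh minimizer; there all matrices are equal. *)
case: n => [|n] in A B Q Pi P A_L1 B_L2 ctrl Q_L1 Q_ge0 Pi_sym Pi_sol Pi_T P_pd P_sol P_T *.
  have E0 (M N : 'M[K]_0) : M = N by rewrite (flatmx0 M) (flatmx0 N).
  split=> [t t0 tT|a b ab]; last first.
    by exists 0 => i s _ _ _; rewrite (E0 (Pi i s) 0) normr0.
  split=> [i i1|].
    split; first by apply/symmetricmxP; exact: E0.
    by move=> v; rewrite (flatmx0 v) mulmx0 mxE.
  by rewrite (_ : (fun i => Pi i t) = (fun=> P t)); [exact: cvg_cst|apply/funext => i; exact: E0].
have [k [kL1 k0 kbnd]] := Lp_mx_dominated A_L1 B_L2 Q_L1.
have [kap [kM [kap0 ackap dkap]]] := integral_primitive kL1 k0.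
pose S s := B s *m invmx (R s) *m (B s)^T.
(* Two matrix products give [m%:R ^+ 2], and [R >= delta I] bounds the inverse of [R] by
   [delta^-1]. *)
pose cS := m%:R ^+ 2 * delta^-1.
have cS0 : 0 <= cS by rewrite mulr_ge0 ?exprn_ge0// invr_ge0 ltW.
have coef : {ae @lebesgue_measure K, forall s, 0 < s -> s < T ->
     [/\ `|A s| <= k s, `|S s| <= cS * k s, (S s)^T = S s &
      [/\ `|Q s| <= k s, (Q s)^T = Q s & forall v, 0 <= qform (Q s) v]]}.
  apply: filterS2 Q_ge0 R_ge => s Qs Rs s0 sT.
  have sI : `]0, T[%classic s by rewrite /= in_itv/= s0.
  have [Ak Bk Qk] := kbnd s s0 sT.
  have [/symmetricmxP QT [_ Q0]] := Qs sI.
  have [/symmetricmxP RT [_ Rd]] := Rs sI.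
  have iR : `|invmx (R s)| <= delta^-1.
    apply: qform_ge_invmx_norm => // v; rewrite -qform_scalar -subr_ge0 -qformB.
    exact: Rd.
  split => //; last by split => // v; have := Q0 v; rewrite subr0.
  - rewrite (le_trans (mx_norm_mul _ _))// mx_norm_tr.
    apply: (@le_trans _ _ (m%:R * (m%:R * `|B s| * delta^-1) * `|B s|)).
      rewrite ler_wpM2r// ler_wpM2l// (le_trans (mx_norm_mul _ _))//.
      by rewrite ler_wpM2l ?mulr_ge0.
    rewrite [leLHS](_ : _ = cS * `|B s| ^+ 2); last by rewrite /cS; ring.
    by rewrite ler_wpM2l.
  - by rewrite /S !trmx_mul trmxK trmx_inv RT mulmxA.
have sol J X a b : riccati_sol A B Q R J X -> `[a, b] `<=` J ->
    (forall s, a <= s -> s <= b -> (X s)^T = X s) -> riccati_on A Q S a b X.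
  move=> [_ [acX dX]] abJ symX; split => //; first exact: acX.
  apply: filterS dX => s Xs as_ sb.
  have /Xs : J s by apply: abJ; rewrite /= in_itv/= !ltW.
  by rewrite /riccati_rhs /S !mulmxA.
have solPi i : (1 <= i)%N -> riccati_on A Q S 0 T (Pi i).
  move=> i1; apply: sol (Pi_sol i i1) _ _ => // s s0 sT.
  by apply/symmetricmxP; exact: Pi_sym.
have PT s : 0 <= s -> s < T -> (P s)^T = P s.
  by move=> s0 sT; apply/symmetricmxP; have [] := P_pd s s0 sT.
have solP b : 0 <= b -> b < T -> riccati_on A Q S 0 b P.
  move=> b0 bT; apply: sol P_sol _ _.
    by move=> s; rewrite /= !in_itv/= => /andP[-> sb]; exact: le_lt_trans bT.
  by move=> s s0 sb; apply: PT => //; exact: le_lt_trans bT.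
have blowup c t : t < T ->
    exists s, [/\ t < s, s < T & forall v, c * sqn v <= qform (P s) v].
  move=> tT; have tT' : Num.max 0 t < T by rewrite gt_max T_gt0.
  have [s [+ sT Ps]] : exists s, [/\ Num.max 0 t < s, s < T & c <= min_spectrum (P s)].
    apply: (@filter_ex _ (T^'-)).
    move/cvgryPge : P_T => /(_ c) Pc; near=> s; split.
    - by near: s; exact: nbhs_left_gt.
    - by near: s; exact: nbhs_left_lt.
    - by near: s.
  rewrite gt_max => /andP[s0 ts]; exists s; split => //; apply/rayleigh_min_ge.
  by rewrite (le_trans Ps)// min_spectrum_le_rayleigh_min// PT// ltW.
split=> [t t0 tT|a b ab].
  split=> [i i1|].
    split; first by rewrite /=; apply/symmetricmxP; rewrite linearB/=;
      congr (_ - _); apply/symmetricmxP; apply: Pi_sym => //; exact: ltW.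
    move=> v; rewrite -/(qform _ _) qformB subr_ge0.
    exact: (riccati_seq_nondecreasing cS0 kap0 ackap dkap coef solPi Pi_T v i1 t0 (ltW tT)).
  exact: (riccati_seq_cvg cS0 kap0 ackap dkap coef T_gt0 solPi Pi_T solP blowup t0 tT).
(* An empty interval lies in [[0, T[] wherever its endpoints are, so it is treated apart. *)
have [ba|ab'] := ltP b a.
  by exists 0 => i s _ as_ sb; have := lt_le_trans ba (le_trans as_ sb); rewrite ltxx.
have : `[0, T[%classic a by apply: ab; rewrite /= in_itv/= lexx.
have : `[0, T[%classic b by apply: ab; rewrite /= in_itv/= lexx andbT.
rewrite /= !in_itv/= => /andP[b0 bT] /andP[a0 aT].
have [acP _ _] := solP b b0 bT.
have [M M0 PM] := abs_continuous_bounded acP.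
exists (n.+1%:R ^+ 2 * M) => i s i1 as_ sb.
have s0 := le_trans a0 as_; have sT := le_lt_trans sb bT.
have := riccati_seq_norm_le cS0 kap0 ackap dkap coef T_gt0 solPi Pi_T solP blowup i1 s0 sT.
by move/le_trans; apply; rewrite ler_wpM2l ?exprn_ge0// PM.
Unshelve. all: by end_near. Qed.
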